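(* Assume there exist a constant $L>0$ and a polynomial $p$ such that the class of linear threshold circuits of depth $L$ and size $p(n)$ over $n$ binary inputs is not weakly PAC-learnable in time polynomial in $n$ (i.e., not learnable in polynomial time even to some constant accuracy $\epsilon<0.5$ and confidence $\delta<1$). Then there is no algorithm that e2e-learns $\mathcal F_{d,\mathrm{lin}}^{\mathrm{e2e}(T)}$ over $\{0,1\}^n$ in time polynomial in $d,T,n$, even to within constants $\epsilon<0.5$, $\delta<1$.
   Context: $\mathcal F_{d,\mathrm{lin}}$: generators $f_{\mathbf w,b}:\{0,1\}^*\to\{0,1\}$, $f_{\mathbf w,b}(\mathbf x)=\mathbf 1[\sum_{i=1}^{\min(d,|\mathbf x|)}\mathbf w[-i]\mathbf x[-i]+b\ge0]$, $\mathbf w\in\mathbb R^d$, $b\in\mathbb R$ ($\mathbf v[-i]$ the $i$-th entry from the end). For $f$, $\bar f(\mathbf x)$ is $\mathbf x$ with $f(\mathbf x)$ appended, $f^{\mathrm{CoT}(T)}=\bar f^{\circ T}$, $f^{\mathrm{e2e}(T)}(\mathbf x)$ the last token of $f^{\mathrm{CoT}(T)}(\mathbf x)$. e2e-learning over $\{0,1\}^n$: the algorithm receives i.i.d. samples $(\mathbf x_i,f_*^{\mathrm{e2e}(T)}(\mathbf x_i))$, $\mathbf x_i\sim\mathcal D$ for an arbitrary distribution $\mathcal D$ on $\{0,1\}^n$ and arbitrary $f_*\in\mathcal F_{d,\mathrm{lin}}$, and must output (possibly improperly) $h:\{0,1\}^n\to\{0,1\}$ with $\Pr_{\mathbf x\sim\mathcal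 D}[h(\mathbf x)\ne f_*^{\mathrm{e2e}(T)}(\mathbf x)]\le\epsilon$ with probability $\ge1-\delta$. A linear threshold circuit on $n$ inputs is a DAG with $n$ input nodes (no incoming edges) holding $x_1,\dots,x_n$, a single output node (no outgoing edges), and real edge weights $w$; each non-input node $v$ has value $\mathbf 1[\sum_{(u,v)}w(u,v)\,\mathrm{val}(u)\ge0]$, and the circuit outputs the value of the output node. Depth is the longest input-to-output path length; size is the number of non-input nodes. *)

(* Defs.v *)
From HB Require Import structures.
From mathcomp Require Import all_boot all_order all_algebra.
From mathcomp Require Import Rstruct.
From Stdlib Require Rdefinitions.
Local Notation R := Rdefinitions.R.
Set Implicit Arguments. Unset Strict Implicit. Unset Printing Implicit Defensive.
Import Order.TTheory GRing.Theory Num.Theory.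
Local Open Scope ring_scope.

(* f_{w,b}(x) = 1[ sum_{i=1}^{min(d,|x|)} w[-i] x[-i] + b >= 0 ],
   w : 'I_d -> R is the vector (w_0,...,w_{d-1}); w[-(i+1)] = w (rev_ord i). *)
Definition lin_gen (d : nat) (w : 'I_d -> R) (b : R) (x : seq bool) : bool :=
  0 <= \sum_(i < d | (i < size x)%N)
         w (rev_ord i) * ((nth false x (size x - i.+1) : nat)%:R : R) + b.

Definition bar (f : seq bool -> bool) (x : seq bool) : seq bool := rcons x (f x).

Definition cot (f : seq bool -> bool) (T : nat) (x : seq bool) : seq bool :=
  iter T (bar f) x.

Definition e2e (f : seq bool -> bool) (T : nat) (x : seq bool) : bool :=
  last false (cot f T x).

(* A circuit on cn inputs with cs non-input nodes (gates) 0..cs-1, listed in a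
   topological order (every DAG admits one); the output node is the last gate.
   ein i j : there is an edge from input j to gate i (weight win i j);
   eg i j  : there is an edge from gate j to gate i, only meaningful for j < i
             (weight wg i j). *)
Record circuit := Circuit {
  cn : nat;
  cs : nat;
  ein : nat -> nat -> bool;
  win : nat -> nat -> R;
  eg : nat -> nat -> bool;
  wg : nat -> nat -> R }.

Definition gate_val (C : circuit) (x : seq bool) (v : seq bool) (k : nat) : bool :=
  0 <= \sum_(j < cn C | ein C k j) win C k j * ((nth false x j : nat)%:R : R)
     + \sum_(j < k | eg C k j) wg C k j * ((nth false v j : nat)%:R : R).

Fixpoint gate_vals (C : circuit) (x : seq bool) (k : nat) : seq bool :=
  match k with
  | 0 => [::]
  | k'.+1 => let v := gate_vals C x k' in rcons v (gate_val C x v k')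
  end.

Definition circ_eval (C : circuit) (x : seq bool) : bool :=
  last false (gate_vals C x (cs C)).

Fixpoint gate_depths (C : circuit) (k : nat) : seq nat :=
  match k with
  | 0 => [::]
  | k'.+1 => let v := gate_depths C k' in
             rcons v (\max_(j < k' | eg C k' j) nth 0%N v j).+1
  end.

Definition circ_depth (C : circuit) : nat := last 0%N (gate_depths C (cs C)).
Definition circ_size (C : circuit) : nat := cs C.

(* well-formedness: at least one gate (the output node is a non-input node),
   and input nodes are exactly the nodes without incoming edges, i.e. every
   gate has an incoming edge *)
Definition circ_wf (C : circuit) : Prop :=
  (0 < cs C)%N /\
  forall i, (i < cs C)%N ->
    (exists2 j, (j < cn C)%N & ein C i j) \/ (exists2 j, (j < i)%N & eg C i j).

Definition in_circ_class (L : nat) (p : {poly int}) (n : nat) (C : circuit) : Prop :=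
  [/\ circ_wf C, cn C = n, (circ_depth C <= L)%N & (circ_size C)%:Z <= p.[n%:Z]].

(*   tape 1: work tape, initially holds the input (parameters, test x)  *)
(*   tape 2: stream of i.i.d. labelled examples  x_1 y_1 # x_2 y_2 # ...*)
(*   tape 3: stream of independent uniform random bits                  *)
(* A learner is a machine that, given the example stream, the random    *)
(* bits and a test point x, outputs a label; the hypothesis h is        *)
(* x |-> that output (the sample and coin tosses being fixed). The      *)
(* running time bounds the total time (learning + evaluating h).        *)

Inductive sym := S0 | S1 | Blk | Sep.
Inductive move := MoveL | MoveR | Stay.

Record tape := Tape { cont : int -> sym; hd : int }.

Definition rd (t : tape) : sym := cont t (hd t).

Definition shift (m : move) : int :=
  match m with MoveL => -1 | MoveR => 1 | Stay => 0 end.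

Definition wr_mv (t : tape) (s : sym) (m : move) : tape :=
  Tape (fun i => if i == hd t then s else cont t i) (hd t + shift m).

(* finitely many states 'I_(nq.+1); start state ord0; delta = None : halt *)
Record TM := MkTM {
  nq : nat;
  delta : 'I_nq.+1 -> sym -> sym -> sym ->
          option ('I_nq.+1 * (sym * move) * (sym * move) * (sym * move)) }.

Record config (M : TM) := Config {
  cst : 'I_(nq M).+1; tp1 : tape; tp2 : tape; tp3 : tape }.

Definition step (M : TM) (c : config M) : option (config M) :=
  match delta (cst c) (rd (tp1 c)) (rd (tp2 c)) (rd (tp3 c)) with
  | None => None
  | Some (q, (s1, m1), (s2, m2), (s3, m3)) =>
      Some (Config q (wr_mv (tp1 c) s1 m1) (wr_mv (tp2 c) s2 m2) (wr_mv (tp3 c) s3 m3))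
  end.

Fixpoint run (M : TM) (fuel : nat) (c : config M) : option (config M) :=
  match step c with
  | None => Some c
  | Some c' => match fuel with 0 => None | f.+1 => run f c' end
  end.

Definition tape_of (s : seq sym) : tape :=
  Tape (fun i : int => if (0 <= i)%R then nth Blk s `|i|%N else Blk) 0.

Definition sym_of_bool (b : bool) : sym := if b then S1 else S0.
Definition enc_bits (x : seq bool) : seq sym := map sym_of_bool x.
Definition enc_samples (S : seq (seq bool * bool)) : seq sym :=
  flatten [seq enc_bits s.1 ++ [:: sym_of_bool s.2; Sep] | s <- S].

Definition init (M : TM) (w : seq sym) (S : seq (seq bool * bool)) (r : seq bool)
  : config M :=
  Config (ord0 : 'I_(nq M).+1) (tape_of w) (tape_of (enc_samples S)) (tape_of (enc_bits r)).

Definition out_bit (M : TM) (oc : option (config M)) : bool :=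
  match oc with Some c => if rd (tp1 c) is S1 then true else false | None => false end.

(* Within t steps the heads only see cells 0..t, so giving t+1 examples and
   t+1 random bits is the same as giving infinite i.i.d. streams. *)
Definition runs_within (M : TM) (t n : nat) (w : seq bool -> seq sym) : Prop :=
  forall (x : seq bool) (S : seq (seq bool * bool)) (r : seq bool),
    size x = n -> size S = t.+1 -> all (fun s => size s.1 == n) S ->
    size r = t.+1 -> run t (@init M (w x) S r) <> None.

Definition is_distr (n : nat) (D : n.-tuple bool -> R) : Prop :=
  (forall x, 0 <= D x) /\ \sum_(x : n.-tuple bool) D x = 1.

Definition hyp (M : TM) (t n : nat) (w : seq bool -> seq sym) (f : seq bool -> bool)
  (s : {ffun 'I_t.+1 -> n.-tuple bool}) (r : t.+1.-tuple bool) (x : seq bool) : bool :=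
  out_bit (run t (@init M (w x) [seq ((s i : seq bool), f (s i)) | i <- enum 'I_t.+1] r)).

Definition hyp_err (M : TM) (t n : nat) (w : seq bool -> seq sym) (f : seq bool -> bool)
  (D : n.-tuple bool -> R) (s : {ffun 'I_t.+1 -> n.-tuple bool}) (r : t.+1.-tuple bool) : R :=
  \sum_(x : n.-tuple bool | @hyp M t n w f s r x != f x) D x.

Definition succ_prob (M : TM) (t n : nat) (w : seq bool -> seq sym) (f : seq bool -> bool)
  (D : n.-tuple bool -> R) (eps : R) : R :=
  \sum_(s : {ffun 'I_t.+1 -> n.-tuple bool})
    \sum_(r : t.+1.-tuple bool)
      (\prod_(i < t.+1) D (s i)) * (2%:R ^- t.+1) *
      (if @hyp_err M t n w f D s r <= eps then 1 else 0).

Definition learns (M : TM) (t n : nat) (w : seq bool -> seq sym) (f : seq bool -> bool)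
  (D : n.-tuple bool -> R) (eps delta : R) : Prop :=
  1 - delta <= @succ_prob M t n w f D eps.

Definition circ_input (x : seq bool) : seq sym := enc_bits x.
Definition e2e_input (d T : nat) (x : seq bool) : seq sym :=
  nseq d S1 ++ Sep :: nseq T S1 ++ Sep :: enc_bits x.

Definition circ_weakly_learnable (L : nat) (p : {poly int}) : Prop :=
  exists (M : TM) (c k : nat) (eps delta : R),
    [/\ eps < 1/2, delta < 1 &
      forall n : nat,
        let t := (c * (n.+1) ^ k)%N in
        runs_within M t n circ_input /\
        forall (D : n.-tuple bool -> R) (C : circuit),
          is_distr D -> in_circ_class L p n C ->
          @learns M t n circ_input (circ_eval C) D eps delta].

Definition lin_e2e_learnable : Prop :=
  exists (M : TM) (c k : nat) (eps delta : R),
    [/\ eps < 1/2, delta < 1 &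
      forall d T n : nat,
        let t := (c * (d + T + n).+1 ^ k)%N in
        runs_within M t n (e2e_input d T) /\
        forall (D : n.-tuple bool -> R) (w : 'I_d -> R) (b : R),
          is_distr D ->
          @learns M t n (e2e_input d T) (e2e (lin_gen w b) T) D eps delta].

(* Main.v *)
Require Import Defs.
From HB Require Import structures.
From mathcomp Require Import all_boot all_order all_algebra.
From mathcomp Require Import Rstruct zify.
From Stdlib Require Import FunctionalExtensionality.
Local Open Scope ring_scope.
Set Implicit Arguments. Unset Strict Implicit. Unset Printing Implicit Defensive.
Import Order.TTheory GRing.Theory Num.Theory.

(* A circuit is simulated by a single linear generator because the weight applied to a
   token depends only on its distance to the current position, and all distances that
   matter can be made distinct.  With G = g + 1, the input x is replaced by
   phi(x) = 1 0^g x_1 0^g ... x_n 0^g, so that the distance between time t < G and the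
   j-th spread bit determines (j, t) by division by G; gate k is evaluated at time
   const + k (s^2 + 1) + k^2, a Sidon set, so that the distance between two gates
   determines both.  The leading 1 acts as a clock that supplies a time-dependent bias,
   which silences the times at which no gate is evaluated.

   A learner for circuits therefore transforms its test point and its examples by phi, in
   place on its tapes, and runs the e2e learner on the result.  Only finitely many
   examples can be transformed beforehand, but a run of t steps sees only the cells at
   distance at most t from the initial heads, so t + 1 examples and any garbage further
   away are enough. *)

(** * Turing machines on zipper tapes *)
Local Open Scope nat_scope.

Definition stream := nat -> sym.
Definition scons (a : sym) (s : stream) : stream := fun n => if n is m.+1 then s m else a.
Definition stail (s : stream) : stream := fun n => s n.+1.
Definition blanks : stream := fun=> Blk.
Fixpoint sapp (l : seq sym) (s : stream) : stream :=
  if l is a :: l' then scons a (sapp l' s) else s.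

Lemma scons_eta s : scons (s 0) (stail s) = s.
Proof. by apply: functional_extensionality; case. Qed.

Lemma scons_blanks : scons Blk blanks = blanks.
Proof. by apply: functional_extensionality; case. Qed.

Lemma sapp_cat l1 l2 s : sapp (l1 ++ l2) s = sapp l1 (sapp l2 s).
Proof. by elim: l1 => //= a l ->. Qed.

Lemma sapp_nseqS m a s : sapp (nseq m a) (scons a s) = scons a (sapp (nseq m a) s).
Proof. by elim: m => //= m ->. Qed.

Lemma sapp_lt l s i : i < size l -> sapp l s i = nth Blk l i.
Proof. by elim: l i => // a l IH [|i] //=; apply: IH. Qed.

Lemma sapp_blanks l i : sapp l blanks i = nth Blk l i.
Proof. by elim: l i => [|a l IH] [|i] //=; apply: IH. Qed.

(* A tape seen from its head: the cells on the left, nearest first, and the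
   cells on the right, starting with the scanned one. *)
Definition ztape := (stream * stream)%type.

Definition zrd (z : ztape) : sym := z.2 0.
Definition zput (s : sym) (z : ztape) : ztape := (z.1, scons s (stail z.2)).
Definition zmove (m : move) (z : ztape) : ztape :=
  match m with
  | MoveL => (stail z.1, scons (z.1 0) z.2)
  | MoveR => (scons (z.2 0) z.1, stail z.2)
  | Stay => z
  end.

Arguments zput : simpl never.

Lemma zput_zrd z : zput (zrd z) z = z.
Proof. by case: z => l r; rewrite /zput /zrd /= scons_eta. Qed.

Definition zview (t : tape) : ztape :=
  (fun n => cont t (hd t - n.+1%:Z)%R, fun n => cont t (hd t + n%:Z)%R).

Arguments zrd : simpl never.
Arguments zview : simpl never.

Lemma zrd_zview t : zrd (zview t) = rd t.
Proof. by rewrite /zrd /zview /rd /= GRing.addr0. Qed.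

Lemma zview_wr_mv t s m : zview (wr_mv t s m) = zmove m (zput s (zview t)).
Proof.
rewrite /zview /wr_mv; case: m => /=; congr pair;
  apply: functional_extensionality => -[|[|n]] /=; rewrite /stail /=;
  case: eqP => // E; try (exfalso; lia); apply: (f_equal (cont t)); lia.
Qed.

Lemma zview_tape_of s : zview (tape_of s) = (blanks, sapp s blanks).
Proof.
congr pair; apply: functional_extensionality => n; rewrite /tape_of /=.
by rewrite sapp_blanks.
Qed.

Definition ztapes := (ztape * ztape * ztape)%type.
Definition action := (sym * move)%type.

(** States range over an arbitrary finite type, so that the combinators below can form theirs by
    sums and options; [to_TM] numbers them at the end. *)
Record machine := Machine {
  mstate : finType;
  mstart : mstate;
  mdelta : mstate -> sym -> sym -> sym -> option (mstate * action * action * action) }.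

Definition zact (w : action) (z : ztape) : ztape := zmove w.2 (zput w.1 z).

Fixpoint mrun (P : machine) (n : nat) (q : mstate P) (z : ztapes) : option ztapes :=
  match mdelta q (zrd z.1.1) (zrd z.1.2) (zrd z.2) with
  | None => Some z
  | Some (q', wa, wb, wc) =>
      if n is m.+1 then mrun m q' (zact wa z.1.1, zact wb z.1.2, zact wc z.2) else None
  end.

Definition exec (P : machine) (n : nat) (z z' : ztapes) : Prop :=
  mrun n (mstart P) z = Some z'.

Lemma mrun_le (P : machine) n m (q : mstate P) z z' :
  n <= m -> mrun n q z = Some z' -> mrun m q z = Some z'.
Proof.
elim: n m q z => [|n IH] [|m] q z //=; case: mdelta => [[[[q' wa] wb] wc]|] //.
by move=> le; apply: IH.
Qed.

Lemma exec_le P n m z z' : exec P n z z' -> n <= m -> exec P m z z'.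
Proof. by move=> e le; apply: mrun_le e. Qed.

Section ToTM.
Variable P : machine.

(** A [TM] starts in [ord0], so index 0 is a spare copy of the start state; [encode] only produces
    indices from 1 on. *)
Definition decode (i : 'I_(#|mstate P|.+1)) : mstate P :=
  nth (mstart P) (mstart P :: enum (mstate P)) i.
Definition encode (q : mstate P) : 'I_(#|mstate P|.+1) :=
  inord (index q (enum (mstate P))).+1.

Lemma encodeK : cancel encode decode.
Proof.
move=> q; rewrite /decode /encode inordK /=; last first.
  by rewrite !ltnS cardE index_mem mem_enum.
by rewrite nth_index // mem_enum.
Qed.

Definition to_TM : TM :=
  @MkTM #|mstate P| (fun i a b c =>
    if mdelta (decode i) a b c is Some (q, wa, wb, wc)
    then Some (encode q, wa, wb, wc) else None).

Definition zviews (M : TM) (c : config M) : ztapes :=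
  (zview (tp1 c), zview (tp2 c), zview (tp3 c)).

Lemma run_to_TM n (c : config to_TM) z :
  mrun n (decode (cst c)) (zviews c) = Some z ->
  exists2 c', run n c = Some c' & zviews c' = z.
Proof.
elim: n c => [|n IH] c /=; rewrite /step /= !zrd_zview;
  case: mdelta => [[[[q [sa ma]] [sb mb]] [sc mc]]|] //=; try by case=> <-; exists c.
rewrite /zact /= -!zview_wr_mv => H.
by apply: IH; rewrite /= encodeK.
Qed.

End ToTM.

Section FromTM.
Variable M : TM.

(* The transducer leaves the examples on tape 1 and the test point on tape 2. *)
Definition swapped : machine :=
  @Machine 'I_(nq M).+1 ord0 (fun q a b c =>
    if delta q b a c is Some (q', w1, w2, w3) then Some (q', w2, w1, w3) else None).

Definition zagree (r : nat) (z1 z2 : ztape) : Prop :=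
  forall i, i <= r -> z1.1 i = z2.1 i /\ z1.2 i = z2.2 i.

Lemma zagree_rd r z1 z2 : zagree r z1 z2 -> zrd z1 = zrd z2.
Proof. by move=> /(_ 0) []. Qed.

(** The head moves by at most one cell, so a step costs one unit of the radius of agreement. *)
Lemma zagree_act r w z1 z2 : zagree r.+1 z1 z2 -> zagree r (zact w z1) (zact w z2).
Proof.
case: w => s m H i le_ir.
have HL j (lej : j <= r.+1) : z1.1 j = z2.1 j by case: (H j lej).
have HR j (lej : j <= r.+1) : z1.2 j = z2.2 j by case: (H j lej).
by case: m; case: i le_ir => [|[|i]] le /=; rewrite /stail /=; split;
  first [by [] | apply: HL; lia | apply: HR; lia].
Qed.

(** A run of [n] steps stays within radius [n], so it can be replayed on tapes that agree only that
    far. Only the scanned symbol of the result is compared: it is the output, and the tapes may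
    differ elsewhere. *)
Lemma mrun_swapped n r (c c' : config M) z :
  run n c = Some c' -> n <= r ->
  zagree r (zview (tp1 c)) z.1.2 -> zagree r (zview (tp2 c)) z.1.1 ->
  zagree r (zview (tp3 c)) z.2 ->
  exists2 z', @mrun swapped n (cst c) z = Some z' & zrd z'.1.2 = rd (tp1 c').
Proof.
elim: n r c z => [|n IH] r c [[za zb] zc] /=; rewrite /step;
  move=> + le_nr Ha Hb Hc;
  rewrite -(zagree_rd Ha) -(zagree_rd Hb) -(zagree_rd Hc) !zrd_zview;
  case: delta => [[[[q [sa ma]] [sb mb]] [sc mc]]|] //=;
  try by case=> <-; exists (za, zb, zc); rewrite //= -(zagree_rd Ha) zrd_zview.
case: r le_nr Ha Hb Hc => // r le_nr Ha Hb Hc /(IH r); apply => //=;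
  by rewrite zview_wr_mv; apply: (@zagree_act _ (_, _)).
Qed.

End FromTM.

(** * Sequential composition, branching and loops of machines *)

Definition keep (z : sym) : action := (z, Stay).

Definition mseq (P Q : machine) : machine :=
  @Machine (mstate P + mstate Q)%type (inl (mstart P)) (fun q a b c =>
    match q with
    | inl q1 => if mdelta q1 a b c is Some (q', wa, wb, wc) then Some (inl q', wa, wb, wc)
                else Some (inr (mstart Q), keep a, keep b, keep c)
    | inr q2 => if mdelta q2 a b c is Some (q', wa, wb, wc) then Some (inr q', wa, wb, wc)
                else None
    end).

Definition test := sym -> sym -> sym -> bool.
Definition holds (t : test) (z : ztapes) : bool := t (zrd z.1.1) (zrd z.1.2) (zrd z.2).

Definition mif (t : test) (P Q : machine) : machine :=
  @Machine (option (mstate P + mstate Q)) None (fun q a b c =>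
    match q with
    | None => Some (Some (if t a b c then inl (mstart P) else inr (mstart Q)),
                    keep a, keep b, keep c)
    | Some (inl q1) =>
        if mdelta q1 a b c is Some (q', wa, wb, wc) then Some (Some (inl q'), wa, wb, wc)
        else None
    | Some (inr q2) =>
        if mdelta q2 a b c is Some (q', wa, wb, wc) then Some (Some (inr q'), wa, wb, wc)
        else None
    end).

Definition mwhile (t : test) (P : machine) : machine :=
  @Machine (option (mstate P)) None (fun q a b c =>
    match q with
    | None => if t a b c then Some (Some (mstart P), keep a, keep b, keep c) else None
    | Some q1 =>
        if mdelta q1 a b c is Some (q', wa, wb, wc) then Some (Some q', wa, wb, wc)
        else Some (None, keep a, keep b, keep c)
    end).

Definition mact (f : sym -> sym -> sym -> action * action * action) : machine :=
  @Machine bool true (fun q a b c =>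
    if q then let: (wa, wb, wc) := f a b c in Some (false, wa, wb, wc) else None).

Lemma zact_keep z : zact (keep (zrd z)) z = z.
Proof. by rewrite /zact /= zput_zrd. Qed.

(** The additional step is the handover from the halting state of [P] to the start of [Q]; fuel that
    [P] leaves over is absorbed by [mrun_le]. *)
Lemma exec_seq P Q n m z z1 z2 :
  exec P n z z1 -> exec Q m z1 z2 -> exec (mseq P Q) (n + m).+1 z z2.
Proof.
rewrite /exec /= => + H2.
have HQ: forall k (q : mstate Q) y y', mrun k q y = Some y' ->
    @mrun (mseq P Q) k (inr q) y = Some y'.
  elim=> [|k IH] q y y' /=; case: mdelta => [[[[q' wa] wb] wc]|] //.
  exact: IH.
elim: n (mstart P) z => [|n IH] q [[a b] c] /=;
  case E: mdelta => [[[[q' wa] wb] wc]|] //=.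
- by case=> E1; rewrite -E1 {E1} in H2; rewrite !zact_keep add0n; apply: HQ.
- exact: IH.
case=> E1; rewrite -E1 {E1} in H2; rewrite !zact_keep.
have H3 : mrun (n + m).+1 (mstart Q) (a, b, c) = Some z2 by apply: mrun_le H2; lia.
exact: (HQ _ _ _ _ H3).
Qed.

Lemma exec_if t P Q n z z' :
  (if holds t z then exec P n z z' else exec Q n z z') -> exec (mif t P Q) n.+1 z z'.
Proof.
case: z => [[a b] c]; rewrite /holds /exec /= !zact_keep; case: ifP => _.
  elim: n (mstart P) a b c => [|n IH] q a b c /=; case: mdelta => [[[[q' wa] wb] wc]|] //.
  exact: IH.
elim: n (mstart Q) a b c => [|n IH] q a b c /=; case: mdelta => [[[[q' wa] wb] wc]|] //.
exact: IH.
Qed.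

Lemma exec_while_false t P z : ~~ holds t z -> exec (mwhile t P) 0 z z.
Proof. by rewrite /exec /holds /= => /negbTE ->. Qed.

(** Of the two additional steps, one enters the body and one returns to the test. *)
Lemma exec_while_true t P n m z z1 z2 :
  holds t z -> exec P n z z1 -> exec (mwhile t P) m z1 z2 ->
  exec (mwhile t P) (n + m).+2 z z2.
Proof.
case: z => [[a b] c]; rewrite /exec /holds /= => -> + H2; rewrite !zact_keep.
elim: n (mstart P) a b c => [|n IH] q a b c /=;
  case E: mdelta => [[[[q' wa] wb] wc]|] //=.
- by case=> E1; rewrite -E1 {E1} in H2; rewrite !zact_keep add0n.
- exact: IH.
case=> E1; rewrite -E1 {E1} in H2; rewrite !zact_keep.
have H3 : @mrun (mwhile t P) (n + m).+1 None (a, b, c) = Some z2 by apply: mrun_le H2; lia.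
exact: H3.
Qed.

(* In [inv u v], [u] lists the processed items, last one first, and [v] the remaining ones. *)
Lemma exec_while_list (T : Type) (p : pred T) (inv : seq T -> seq T -> ztapes) t P k l :
  (forall u, all p u -> ~~ holds t (inv u [::])) ->
  (forall u a v, all p u -> all p v -> p a ->
     holds t (inv u (a :: v)) /\ exec P k (inv u (a :: v)) (inv (a :: u) v)) ->
  all p l ->
  exec (mwhile t P) (size l * k.+2) (inv [::] l) (inv (rev l) [::]).
Proof.
move=> H0 H1; rewrite /rev.
suff H u : all p u -> all p l ->
    exec (mwhile t P) (size l * k.+2) (inv u l) (inv (catrev l u) [::]) by exact: H.
elim: l u => [|a l IH] u /= pu pl.
  by apply: (exec_le (n := 0)) => //; apply: exec_while_false; apply: H0.
case/andP: pl => pa pl; have [h e] := H1 u a l pu pl pa.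
apply: exec_le (exec_while_true h e (IH _ _ pl)) _; first by rewrite /= pa.
by rewrite mulSn; lia.
Qed.

Lemma exec_while_nat (inv : nat -> ztapes) t P k m :
  (forall i, i < m -> holds t (inv i) /\ exec P k (inv i) (inv i.+1)) ->
  ~~ holds t (inv m) ->
  exec (mwhile t P) (m * k.+2) (inv 0) (inv m).
Proof.
move=> H1 H0.
suff H j : j <= m -> exec (mwhile t P) (j * k.+2) (inv (m - j)) (inv m).
  by have := H m (leqnn m); rewrite subnn.
elim: j => [_|j IH le]; first by rewrite subn0 mul0n; apply: exec_while_false.
have [|h e] := H1 (m - j.+1); first lia.
have E : (m - j.+1).+1 = m - j by lia.
rewrite E in e; apply: exec_le (exec_while_true h e (IH _)) _; lia.
Qed.

(* [None] keeps the scanned symbol. *)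
Definition cmd := (option sym * move)%type.
Definition cmd_action (k : cmd) (a : sym) : action := (odflt a k.1, k.2).
Definition step3 (ka kb kc : cmd) : machine :=
  mact (fun a b c => (cmd_action ka a, cmd_action kb b, cmd_action kc c)).
Definition zcmd (k : cmd) (z : ztape) : ztape :=
  zmove k.2 (if k.1 is Some s then zput s z else z).

Lemma zact_cmd k z : zact (cmd_action k (zrd z)) z = zcmd k z.
Proof. by case: k => [[s|] m]; rewrite /zact /zcmd //= zput_zrd. Qed.

Lemma exec_step3 ka kb kc za zb zc :
  exec (step3 ka kb kc) 1 (za, zb, zc) (zcmd ka za, zcmd kb zb, zcmd kc zc).
Proof. by rewrite /exec /= !zact_cmd. Qed.

(** * The input transducer *)

Definition is_blk (s : sym) : bool := if s is Blk then true else false.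
Definition is_sep (s : sym) : bool := if s is Sep then true else false.
Definition is_bit (s : sym) : bool := ~~ is_blk s && ~~ is_sep s.

Definition filledA : test := fun a b c => ~~ is_blk a.
Definition filledB : test := fun a b c => ~~ is_blk b.
Definition blankB : test := fun a b c => is_blk b.
Definition sepB : test := fun a b c => is_sep b.
Definition nosepB : test := fun a b c => ~~ is_sep b.
Definition sepC : test := fun a b c => is_sep c.

Definition mv (m : move) : cmd := (None, m).
Definition wr (s : sym) (m : move) : cmd := (Some s, m).
Definition nop : cmd := (None, Stay).

Local Notation "P ;; Q" := (mseq P Q) (at level 60, right associativity).

Lemma stail_scons a s : stail (scons a s) = s.
Proof. by []. Qed.

Lemma stail_blanks : stail blanks = blanks.
Proof. by []. Qed.

Lemma blanks0 n : blanks n = Blk.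
Proof. by []. Qed.

Definition zE := (stail_scons, stail_blanks, blanks0, scons_blanks).

Lemma exec_step3E ka kb kc za zb zc za' zb' zc' :
  zcmd ka za = za' -> zcmd kb zb = zb' -> zcmd kc zc = zc' ->
  exec (step3 ka kb kc) 1 (za, zb, zc) (za', zb', zc').
Proof. by move=> <- <- <-; apply: exec_step3. Qed.

Lemma sapp_nseqD m n a s : sapp (nseq m a) (sapp (nseq n a) s) = sapp (nseq (m + n) a) s.
Proof. by rewrite nseqD sapp_cat. Qed.

Ltac zsimp := rewrite /zcmd /zput /zmove /= ?zE //.
Ltac one_step := apply: exec_step3E; zsimp.
Ltac do_step := eapply exec_seq; [by apply: exec_step3 | rewrite /zcmd /zput /zmove /= ?zE].

Section Loops.
Variables (za zb zc : ztape).

Lemma exec_scanA_right l L s :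
  all (predC is_blk) l -> is_blk (s 0) ->
  exec (mwhile filledA (step3 (mv MoveR) nop nop)) (size l * 3)
    ((L, sapp l s), zb, zc) ((sapp (rev l) L, s), zb, zc).
Proof.
move=> pl s0.
apply: (exec_while_list (p := predC is_blk) (inv := fun u v => ((sapp u L, sapp v s), zb, zc))) => //.
  by move=> u _; rewrite /holds /filledA /zrd /= s0.
by move=> u a v _ _ pa; split; [exact: pa | one_step].
Qed.

(** The head starts on the top of the left stream; writing this as a left move off [(sapp l L, s)]
    also covers an empty [l]. *)
Lemma exec_scanA_left l L s :
  all (predC is_blk) l -> is_blk (L 0) ->
  exec (mwhile filledA (step3 (mv MoveL) nop nop)) (size l * 3)
    (zmove MoveL (sapp l L, s), zb, zc) (zmove MoveL (L, sapp (rev l) s), zb, zc).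
Proof.
move=> pl s0.
apply: (exec_while_list (p := predC is_blk)
  (inv := fun u v => (zmove MoveL (sapp v L, sapp u s), zb, zc))) => //.
  by move=> u _; rewrite /holds /filledA /zrd /= s0.
by move=> u a v _ _ pa; split; [exact: pa | one_step].
Qed.

Lemma exec_scanB_right l L s :
  all (predC is_blk) l -> is_blk (s 0) ->
  exec (mwhile filledB (step3 nop (mv MoveR) nop)) (size l * 3)
    (za, (L, sapp l s), zc) (za, (sapp (rev l) L, s), zc).
Proof.
move=> pl s0.
apply: (exec_while_list (p := predC is_blk) (inv := fun u v => (za, (sapp u L, sapp v s), zc))) => //.
  by move=> u _; rewrite /holds /filledB /zrd /= s0.
by move=> u a v _ _ pa; split; [exact: pa | one_step].
Qed.

Lemma exec_scanB_left l L s :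
  all (predC is_blk) l -> is_blk (L 0) ->
  exec (mwhile filledB (step3 nop (mv MoveL) nop)) (size l * 3)
    (za, zmove MoveL (sapp l L, s), zc) (za, zmove MoveL (L, sapp (rev l) s), zc).
Proof.
move=> pl s0.
apply: (exec_while_list (p := predC is_blk)
  (inv := fun u v => (za, zmove MoveL (sapp v L, sapp u s), zc))) => //.
  by move=> u _; rewrite /holds /filledB /zrd /= s0.
by move=> u a v _ _ pa; split; [exact: pa | one_step].
Qed.

Lemma exec_scanB_blank_left m L s :
  ~~ is_blk (L 0) ->
  exec (mwhile blankB (step3 nop (mv MoveL) nop)) (m * 3)
    (za, zmove MoveL (sapp (nseq m Blk) L, s), zc)
    (za, zmove MoveL (L, sapp (nseq m Blk) s), zc).
Proof.
move=> s0.
have := @exec_while_list _ is_blk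
  (fun u v => (za, zmove MoveL (sapp v L, sapp u s), zc)) blankB
  (step3 nop (mv MoveL) nop) 1 (nseq m Blk).
rewrite size_nseq /rev /=.
have -> : catrev (nseq m Blk) [::] = nseq m Blk.
  by rewrite -/(rev _) rev_nseq.
apply => //.
- by move=> u a v _ _ pa; split; [exact: pa | one_step].
- by rewrite all_nseq orbT.
Qed.

Lemma exec_skipB l L s :
  all (predC is_sep) l -> is_sep (s 0) ->
  exec (mwhile nosepB (step3 nop (mv MoveR) nop)) (size l * 3)
    (za, (L, sapp l s), zc) (za, (sapp (rev l) L, s), zc).
Proof.
move=> pl s0.
apply: (exec_while_list (p := predC is_sep) (inv := fun u v => (za, (sapp u L, sapp v s), zc))) => //.
  by move=> u _; rewrite /holds /nosepB /zrd /= s0.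
by move=> u a v _ _ pa; split; [exact: pa | one_step].
Qed.

End Loops.

(** * Unary counters on tape 3 *)

Section Counters.
(** Tape 3 holds the random bits [rho] from cell 0 on. A counter lies to their left and consists of
    [Sep], so a first symbol other than [Sep] shows where it ends. *)
Variables (rho : stream) (rho0 : ~~ is_sep (rho 0)).

(* [m] marks stacked leftwards from cell -1, the head on the topmost one. *)
Definition marks (m : nat) (s : stream) : ztape := (blanks, sapp (nseq m Sep) s).

(* Multiplies the number of marks on tape 3 by |x| + 2, x being the word on tape 1. *)
Definition mult : machine :=
  step3 nop (mv MoveL) nop ;;
  mwhile sepC
    (step3 nop (wr Sep MoveL) (wr Blk MoveR) ;;
     step3 nop (wr Sep MoveL) nop ;;
     mwhile filledA (step3 (mv MoveR) (wr Sep MoveL) nop) ;;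
     step3 (mv MoveL) nop nop ;;
     mwhile filledA (step3 (mv MoveL) nop nop) ;;
     step3 (mv MoveR) nop nop) ;;
  step3 nop (mv MoveR) (mv MoveL) ;;
  mwhile sepB (step3 nop (wr Blk MoveR) (wr Sep MoveL)) ;;
  step3 nop nop (mv MoveR).

Lemma exec_pushB_scanA l L s zc :
  all (predC is_blk) l ->
  exec (mwhile filledA (step3 (mv MoveR) (wr Sep MoveL) nop)) (size l * 3)
    ((L, sapp l blanks), (blanks, scons Blk s), zc)
    ((sapp (rev l) L, blanks), (blanks, scons Blk (sapp (nseq (size (rev l)) Sep) s)), zc).
Proof.
move=> pl.
apply: (exec_while_list (p := predC is_blk) (inv := fun u v => ((sapp u L, sapp v blanks),
  (blanks, scons Blk (sapp (nseq (size u) Sep) s)), zc))) => //.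
by move=> u a v _ _ pa; split; [exact: pa | one_step].
Qed.

(** The cells to the left of the examples on tape 2 are scratch space: each mark erased on tape 3
    leaves two marks there and one more per letter of [x], and the stack is then carried back to
    tape 3. The hypothesis on [beta] makes the bottom of that stack recognisable. *)
Lemma exec_mult x m beta :
  all is_bit x -> ~~ is_sep (beta 0) ->
  exec mult (50 * (m.+1 * (size x + 2)))
    ((blanks, sapp x blanks), (blanks, beta), marks m rho)
    ((blanks, sapp x blanks), (blanks, beta), marks (m * (size x + 2)) rho).
Proof.
move=> px beta0.
have px' : all (predC is_blk) x by apply: sub_all px => a /andP [].
set N := size x + 2.
have loop1 : exec (mwhile sepC
    (step3 nop (wr Sep MoveL) (wr Blk MoveR) ;;
     step3 nop (wr Sep MoveL) nop ;;
     mwhile filledA (step3 (mv MoveR) (wr Sep MoveL) nop) ;;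
     step3 (mv MoveL) nop nop ;;
     mwhile filledA (step3 (mv MoveL) nop nop) ;;
     step3 (mv MoveR) nop nop)) (m * (10 * N).+2)
   ((blanks, sapp x blanks), (blanks, scons Blk beta), marks m rho)
   ((blanks, sapp x blanks), (blanks, scons Blk (sapp (nseq (m * N) Sep) beta)), marks 0 rho).
  pose inv i : ztapes := ((blanks, sapp x blanks),
    (blanks, scons Blk (sapp (nseq (i * N) Sep) beta)), marks (m - i) rho).
  have -> : marks m rho = marks (m - 0) rho by rewrite subn0.
  rewrite -[in marks 0 rho](subnn m).
  apply: (exec_while_nat (inv := inv)) => [i lti|]; last first.
    by rewrite /inv subnn.
  rewrite /inv; have -> : m - i = (m - i.+1).+1 by lia.
  split; first by [].
  have -> : i.+1 * N = size (rev x) + (i * N).+2 by rewrite size_rev /N; lia.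
  rewrite -sapp_nseqD /=.
  eapply exec_le.
    do 2 do_step.
    eapply exec_seq.
      exact: exec_pushB_scanA px'.
    do_step.
    eapply exec_seq.
      by apply: exec_scanA_left => //; rewrite all_rev.
    by apply: exec_step3E; zsimp; rewrite ?revK ?size_rev.
  rewrite size_rev /N; lia.
pose inv i : ztapes := ((blanks, sapp x blanks),
    (blanks, sapp (nseq (m * N - i) Sep) beta), (blanks, scons Blk (sapp (nseq i Sep) rho))).
have loop2 : exec (mwhile sepB (step3 nop (wr Blk MoveR) (wr Sep MoveL)))
    (m * N * 3) (inv 0) (inv (m * N)).
  apply: exec_while_nat => [i lti|]; last by rewrite /inv subnn.
  rewrite /inv; have -> : m * N - i = (m * N - i.+1).+1 by lia.
  by split; [|one_step].
rewrite {}/inv subn0 subnn in loop2.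
eapply exec_le.
  do_step.
  eapply exec_seq; first exact: loop1.
  do_step.
  eapply exec_seq; first exact: loop2.
  by one_step.
rewrite mulSn -/N; nia.
Qed.

(** All polynomial bounds of the reduction are rounded up to powers of [size x + 2]: this base is at
    least 2 even for empty [x], so constants are absorbed by exponents. *)
Fixpoint power (K : nat) : machine :=
  if K is K'.+1 then power K' ;; mult
  else step3 nop nop (mv MoveL) ;; step3 nop nop (wr Sep Stay).

Lemma exec_power K x beta :
  all is_bit x -> ~~ is_sep (beta 0) ->
  exec (power K) (102 * (K.+1 * (size x + 2) ^ K.+1))
    ((blanks, sapp x blanks), (blanks, beta), marks 0 rho)
    ((blanks, sapp x blanks), (blanks, beta), marks ((size x + 2) ^ K) rho).
Proof.
move=> px b0; elim: K => [|K IH] /=.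
  by eapply exec_le; [do_step; one_step | lia].
have -> : (size x + 2) ^ K.+1 = (size x + 2) ^ K * (size x + 2) by rewrite expnSr.
apply: exec_le (exec_seq IH (exec_mult _ px b0)) _.
set N := size x + 2; have : 0 < N ^ K by rewrite expn_gt0 /N addn2.
rewrite !expnSr ?expnS; move: (N ^ K) => y; nia.
Qed.

Definition raw (s : seq sym * sym) : seq sym := s.1 ++ [:: s.2; Sep].
Definition sample_ok n (s : seq sym * sym) := [&& size s.1 == n, all is_bit s.1 & is_bit s.2].

(* Writes a blank behind as many examples as there are marks on tape 3. *)
Definition cut : machine :=
  mwhile sepC
    (step3 nop nop (wr Blk MoveR) ;;
     mwhile nosepB (step3 nop (mv MoveR) nop) ;;
     step3 nop (mv MoveR) nop) ;;
  step3 nop (wr Blk MoveL) nop ;;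
  mwhile filledB (step3 nop (mv MoveL) nop) ;;
  step3 nop (mv MoveR) nop.

Lemma size_raws n ws : all (sample_ok n) ws -> size (flatten (map raw ws)) = size ws * (n + 2).
Proof.
elim: ws => //= s ws IH /andP [/and3P [/eqP sz _ _] /IH e].
by rewrite !size_cat e sz /= mulSn.
Qed.

Lemma raws_filled n ws : all (sample_ok n) ws ->
  all (predC is_blk) (flatten (map raw ws)).
Proof.
elim: ws => //= s ws IH /andP [/and3P [_ p1 /andP [p2 _]] /IH e].
rewrite !all_cat /= p2 e !andbT; apply: sub_all p1 => a /andP []; exact.
Qed.

(** Each mark pays for skipping one example. The blank that will stop [transduce] overwrites the
    first symbol of the next example, which lies beyond the examples that are kept. *)
Lemma exec_cut n za ws rest :
  all (sample_ok n) ws ->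
  exec cut (10 * ((size ws).+1 * (n + 3)))
    (za, (blanks, sapp (flatten (map raw ws)) rest), marks (size ws) rho)
    (za, (blanks, sapp (flatten (map raw ws)) (scons Blk (stail rest))), marks 0 rho).
Proof.
move=> ok.
pose inv (u v : seq (seq sym * sym)) : ztapes :=
  (za, (sapp (rev (flatten (map raw (rev u)))) blanks, sapp (flatten (map raw v)) rest),
   marks (size v) rho).
eapply exec_le.
  eapply exec_seq.
    apply: (exec_while_list (p := sample_ok n) (inv := inv) (k := 3 * (n + 3))) ok => // u s v _ _.
    case: s => w y /and3P [/= /eqP sz pw py].
    split; first by [].
    rewrite /inv rev_cons map_rcons flatten_rcons rev_cat sapp_cat /raw /= -catA sapp_cat /=.
    eapply exec_le.
      do_step.
      eapply exec_seq.
        rewrite -[scons y _]/(sapp [:: y] _) -sapp_cat.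
        apply: exec_skipB => //; rewrite all_cat /= andbT.
        case/andP: py => _ ->; rewrite andbT; apply: sub_all pw => a /andP []; exact.
      one_step.
      by rewrite !rev_cat.
    rewrite size_cat /=; lia.
  rewrite /inv /= revK.
  do_step.
  eapply exec_seq.
    apply: (@exec_scanB_left _ _ (rev (flatten (map raw ws))) blanks (scons Blk (stail rest))) => //.
    by rewrite all_rev (raws_filled ok).
  by one_step; rewrite revK.
rewrite size_rev (size_raws ok); nia.
Qed.

Definition rewindC : machine :=
  step3 nop nop (mv MoveL) ;;
  mwhile sepC (step3 nop nop (mv MoveL)) ;;
  step3 nop nop (mv MoveR).

Lemma exec_rewindC g za zb :
  exec rewindC (3 * g + 4) (za, zb, (sapp (nseq g Sep) blanks, rho)) (za, zb, marks g rho).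
Proof.
pose inv i : ztapes :=
  (za, zb, zmove MoveL (sapp (nseq (g - i) Sep) blanks, sapp (nseq i Sep) rho)).
have loop : exec (mwhile sepC (step3 nop nop (mv MoveL))) (g * 3) (inv 0) (inv g).
  apply: exec_while_nat => [i lti|]; last by rewrite /inv subnn.
  rewrite /inv; have -> : g - i = (g - i.+1).+1 by lia.
  by split; [|one_step].
rewrite {}/inv subn0 subnn in loop.
eapply exec_le.
  eapply exec_seq; first exact: exec_step3.
  eapply exec_seq; first exact: loop.
  by one_step.
lia.
Qed.

(** The counter acts as the bound of a for loop: one symbol is written per mark, and the rewinding
    keeps the marks for the next use. *)
Definition sweepA (s : sym) : machine :=
  mwhile sepC (step3 (wr s MoveR) nop (mv MoveR)) ;; rewindC.
Definition sweepB (s : sym) : machine :=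
  mwhile sepC (step3 nop (wr s MoveL) (mv MoveR)) ;; rewindC.

Lemma exec_sweepA s g L zb :
  exec (sweepA s) (6 * g + 5) ((L, blanks), zb, marks g rho)
    ((sapp (nseq g s) L, blanks), zb, marks g rho).
Proof.
pose inv i : ztapes := ((sapp (nseq i s) L, blanks), zb,
  (sapp (nseq i Sep) blanks, sapp (nseq (g - i) Sep) rho)).
have loop : exec (mwhile sepC (step3 (wr s MoveR) nop (mv MoveR))) (g * 3) (inv 0) (inv g).
  apply: exec_while_nat => [i lti|]; last by rewrite /inv subnn.
  rewrite /inv; have -> : g - i = (g - i.+1).+1 by lia.
  by split; [|one_step].
rewrite {}/inv subn0 subnn in loop.
eapply exec_le.
  eapply exec_seq; first exact: loop.
  by apply: exec_rewindC.
lia.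
Qed.

Lemma exec_sweepB s g R za :
  exec (sweepB s) (6 * g + 5) (za, (blanks, scons Blk R), marks g rho)
    (za, (blanks, scons Blk (sapp (nseq g s) R)), marks g rho).
Proof.
pose inv i : ztapes := (za, (blanks, scons Blk (sapp (nseq i s) R)),
  (sapp (nseq i Sep) blanks, sapp (nseq (g - i) Sep) rho)).
have loop : exec (mwhile sepC (step3 nop (wr s MoveL) (mv MoveR))) (g * 3) (inv 0) (inv g).
  apply: exec_while_nat => [i lti|]; last by rewrite /inv subnn.
  rewrite /inv; have -> : g - i = (g - i.+1).+1 by lia.
  by split; [|one_step].
rewrite {}/inv subn0 subnn in loop.
eapply exec_le.
  eapply exec_seq; first exact: loop.
  by apply: exec_rewindC.
lia.
Qed.

End Counters.

Definition copyAB : machine := mact (fun a b c => ((a, MoveL), (a, MoveL), keep c)).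
Definition copyBA : machine := mact (fun a b c => ((b, MoveR), (Blk, MoveR), keep c)).

Lemma exec_copyAB za zb zc :
  exec copyAB 1 (za, zb, zc) (zmove MoveL za, zcmd (wr (zrd za) MoveL) zb, zc).
Proof. by rewrite /exec /= zact_keep /zact /= /zrd scons_eta. Qed.

Lemma exec_copyBA za zb zc :
  exec copyBA 1 (za, zb, zc) (zcmd (wr (zrd zb) MoveR) za, zcmd (wr Blk MoveR) zb, zc).
Proof. by rewrite /exec /= zact_keep /zact /=. Qed.

Definition spread (A : Type) (z : A) (g : nat) (w : seq A) : seq A :=
  flatten [seq a :: nseq g z | a <- w].

Lemma size_spread (A : Type) (z : A) g w : size (spread z g w) = size w * g.+1.
Proof.
by elim: w => //= a w IH; rewrite /spread /= size_cat size_nseq -/(spread z g w) IH mulSn.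
Qed.

Lemma spread_filled g w : all is_bit w -> all (predC is_blk) (spread S0 g w).
Proof.
elim: w => //= a w IH /andP [/andP [pa _] /IH]; rewrite /spread /= all_cat pa /= => ->.
by rewrite andbT all_nseq orbT.
Qed.

(** This is the e2e input for [d = (size x + 2) * g.+1] and [T = g.+1]. The window [d] exceeds the
    length [(size x + 1) * g.+1] of the spread word by [T], so it never truncates the context. *)
Definition content (g : nat) (x : seq sym) : seq sym :=
  nseq ((size x + 2) * g.+1) S1 ++ Sep :: nseq g.+1 S1 ++ Sep :: spread S0 g (S1 :: x).

Lemma content_filled g x : all is_bit x -> all (predC is_blk) (content g x).
Proof.
move=> px; have px1 : all is_bit (S1 :: x) by [].
have := spread_filled g px1; rewrite /content; move: (spread _ _ _) => P pP.
by rewrite all_cat /= all_cat /= pP !all_nseq !orbT.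
Qed.

Lemma size_content g x : size (content g x) = (2 * size x + 4) * g.+1 + 2.
Proof.
rewrite /content; have := size_spread S0 g (S1 :: x); move: (spread _ _ _) => P sP.
by rewrite size_cat /= size_cat /= sP !size_nseq /=; lia.
Qed.

Definition expanded (g : nat) (s : seq sym * sym) : seq sym := spread S0 g (S1 :: s.1) ++ [:: s.2; Sep].

(** * Spreading the test point and the examples *)

Section Main.
Variables (rho : stream) (rho0 : ~~ is_sep (rho 0)) (g : nat).

Definition onesB : machine := sweepB S1 ;; step3 nop (wr S1 MoveL) nop.

Lemma exec_onesB R za :
  exec onesB (6 * g + 7) (za, (blanks, scons Blk R), marks g rho)
    (za, (blanks, scons Blk (sapp (nseq g.+1 S1) R)), marks g rho).
Proof.
eapply exec_le.
  eapply exec_seq; first exact: exec_sweepB.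
  by one_step.
lia.
Qed.

(* Writes the input of the e2e learner on tape 2, from right to left, and erases tape 1. *)
Definition build : machine :=
  mwhile filledA (step3 (mv MoveR) nop nop) ;;
  step3 (mv MoveL) (mv MoveL) nop ;;
  step3 nop (mv MoveL) nop ;;
  mwhile filledA (sweepB S0 ;; copyAB) ;;
  sweepB S0 ;;
  step3 nop (wr S1 MoveL) nop ;;
  step3 nop (wr Sep MoveL) nop ;;
  onesB ;;
  step3 (mv MoveR) (wr Sep MoveL) nop ;;
  mwhile filledA (onesB ;; step3 (wr Blk MoveR) nop nop) ;;
  onesB ;;
  onesB ;;
  step3 nop (mv MoveR) nop ;;
  mwhile filledB (step3 nop (mv MoveR) nop) ;;
  step3 nop (mv MoveR) nop.

Lemma exec_build x beta :
  all is_bit x ->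
  exec build (100 * ((size x + 2) * g.+2))
    ((blanks, sapp x blanks), (blanks, beta), marks g rho)
    ((blanks, blanks), (scons Blk (sapp (rev (content g x)) blanks), beta), marks g rho).
Proof.
move=> px; have px' : all (predC is_blk) x by apply: sub_all px => a /andP [].
(* The first pass reads [x] from right to left, so each block is written from its end: [g] zeros,
   then the bit. *)
have loop1 : exec (mwhile filledA (sweepB S0 ;; copyAB)) (size (rev x) * (6 * g + 7).+2)
    (zmove MoveL (sapp (rev x) blanks, blanks), (blanks, scons Blk (scons Blk beta)), marks g rho)
    (zmove MoveL (blanks, sapp (rev (rev x)) blanks),
     (blanks, scons Blk (sapp (spread S0 g (rev (rev x))) (scons Blk beta))), marks g rho).
  apply: (exec_while_list (p := predC is_blk) (inv := fun u v =>
    (zmove MoveL (sapp v blanks, sapp u blanks),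
     (blanks, scons Blk (sapp (spread S0 g u) (scons Blk beta))), marks g rho)) (k := 6 * g + 7)) => //.
    move=> u a v _ _ pa; split; first exact: pa.
    rewrite {2}/spread /= sapp_cat -/(spread S0 g u).
    eapply exec_le.
      eapply exec_seq; [exact: exec_sweepB | exact: exec_copyAB].
    lia.
  by rewrite all_rev.
pose R0 := sapp (Sep :: nseq g.+1 S1 ++ Sep :: spread S0 g (S1 :: x)) (scons Blk beta).
have ER0 : scons Sep (scons S1 (sapp (nseq g S1) (scons Sep (scons S1
    (sapp (nseq g S0) (sapp (spread S0 g x) (scons Blk beta))))))) = R0.
  by rewrite /R0 /= sapp_cat /= sapp_cat.
(* The second pass erases [x], each letter contributing [g.+1] ones to the unary [d]; the two calls
   of [onesB] after it complete [(size x + 2) * g.+1]. *)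
have loop2 : exec (mwhile filledA (onesB ;; step3 (wr Blk MoveR) nop nop))
    (size x * (6 * g + 9).+2)
    ((blanks, sapp x blanks), (blanks, scons Blk R0), marks g rho)
    ((blanks, blanks), (blanks, scons Blk (sapp (nseq (size (rev x) * g.+1) S1) R0)), marks g rho).
  apply: (exec_while_list (p := predC is_blk) (inv := fun u v =>
    ((blanks, sapp v blanks), (blanks, scons Blk (sapp (nseq (size u * g.+1) S1) R0)),
     marks g rho)) (k := 6 * g + 9)) => //.
    move=> u a v _ _ pa; split; first exact: pa.
    eapply exec_le.
      eapply exec_seq; first exact: exec_onesB.
      by one_step; rewrite -[scons S1 _]/(sapp (nseq g.+1 S1) _) sapp_nseqD.
    lia.
eapply exec_le.
  eapply exec_seq; first by apply: exec_scanA_right.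
  do 2 do_step.
  eapply exec_seq; first exact: loop1.
  rewrite revK.
  eapply exec_seq; first exact: exec_sweepB.
  do 2 do_step.
  eapply exec_seq; first exact: exec_onesB.
  do_step.
  rewrite ER0.
  eapply exec_seq; first exact: loop2.
  eapply exec_seq; first exact: exec_onesB.
  eapply exec_seq; first exact: exec_onesB.
  rewrite !sapp_nseqD size_rev.
  have -> : g.+1 + g.+1 + size x * g.+1 = (size x + 2) * g.+1 by lia.
  rewrite /R0 -sapp_cat -/(content g x).
  do_step.
  eapply exec_seq.
    by apply: exec_scanB_right => //; exact: (content_filled g px).
  by one_step.
rewrite size_rev -[size (_ ++ _)]/(size (content g x)) size_content.
nia.
Qed.

(** A label is told apart from the bits before it by the [Sep] that follows it on tape 2, and then
    gets no padding. *)
Definition expand : machine :=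
  step3 (wr S1 MoveR) nop nop ;;
  sweepA S0 ;;
  mwhile nosepB (copyBA ;; mif sepB (step3 nop nop nop) (sweepA S0)) ;;
  step3 (wr Sep MoveR) (wr Blk MoveR) nop.

Lemma exec_expand_loop w y L B rest :
  all is_bit w -> is_bit y ->
  exec (mwhile nosepB (copyBA ;; mif sepB (step3 nop nop nop) (sweepA S0)))
    ((size w).+1 * (6 * g + 20))
    ((L, blanks), (B, sapp w (scons y (scons Sep rest))), marks g rho)
    ((sapp (rev (spread S0 g w ++ [:: y])) L, blanks),
     (sapp (nseq (size w).+1 Blk) B, scons Sep rest), marks g rho).
Proof.
elim: w L B => [|a w IH] L B /= => [_ py|/andP [pa pw] py].
  have [_ ny] := andP py.
  eapply exec_le.
    apply: exec_while_true => //; last by apply: exec_while_false.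
    eapply exec_seq; first exact: exec_copyBA.
    by apply: exec_if; rewrite /holds /sepB /zrd /=; one_step.
  lia.
have [_ na] := andP pa.
eapply exec_le.
  apply: exec_while_true => //.
    eapply exec_seq; first exact: exec_copyBA.
    apply: exec_if; rewrite {1}/zcmd /zput /zmove /= /holds /sepB /zrd /=.
    have -> : is_sep (sapp w (scons y (scons Sep rest)) 0) = false.
      case: w pw {IH} => [_|c w /andP [pc _]] /=; apply/negbTE.
        by case/andP: py.
      by case/andP: pc.
    exact: exec_sweepA.
  rewrite {1}/zcmd /zput /zmove /= !stail_scons.
  have -> : rev (spread S0 g (a :: w) ++ [:: y]) = rev (spread S0 g w ++ [:: y]) ++ nseq g S0 ++ [:: a].
    by rewrite {1}/spread /= -/(spread S0 g w) -catA rev_cons rev_cat rev_nseq -cats1 -catA.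
  rewrite 2!sapp_cat -(sapp_nseqS _.+1) /=.
  exact: IH.
lia.
Qed.

Lemma exec_expand n s L B rest :
  sample_ok n s ->
  exec expand (100 * ((n + 2) * g.+2))
    ((L, blanks), (B, sapp (raw s) rest), marks g rho)
    ((sapp (rev (expanded g s)) L, blanks), (sapp (nseq (n + 2) Blk) B, rest), marks g rho).
Proof.
case: s => w y /and3P [/= /eqP sz pw py].
have -> : rev (expanded g (w, y)) = Sep :: rev (spread S0 g w ++ [:: y]) ++ nseq g S0 ++ [:: S1].
  by rewrite /expanded /spread /= -/(spread S0 g w) rev_cons -catA rev_cat rev_nseq !rev_cat -cats1 -!catA.
eapply exec_le.
  do_step.
  eapply exec_seq; first exact: exec_sweepA.
  rewrite /raw sapp_cat /=.
  eapply exec_seq; first exact: exec_expand_loop.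
  one_step; first by rewrite 2!sapp_cat.
  by rewrite sz -[n + 2]/(n + 1.+1) addnS addn1.
rewrite sz; nia.
Qed.

Definition transduce : machine := mwhile filledB expand.

Lemma exec_transduce n ws L B rest :
  all (sample_ok n) ws -> is_blk (rest 0) ->
  exec transduce (size ws * (100 * ((n + 2) * g.+2)).+2)
    ((L, blanks), (B, sapp (flatten (map raw ws)) rest), marks g rho)
    ((sapp (rev (flatten (map (expanded g) ws))) L, blanks),
     (sapp (nseq (size ws * (n + 2)) Blk) B, rest), marks g rho).
Proof.
move=> ok r0.
pose inv (u v : seq (seq sym * sym)) : ztapes :=
  ((sapp (rev (flatten (map (expanded g) (rev u)))) L, blanks),
   (sapp (nseq (size u * (n + 2)) Blk) B, sapp (flatten (map raw v)) rest), marks g rho).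
have := @exec_while_list _ (sample_ok n) inv filledB expand (100 * ((n + 2) * g.+2)) ws.
rewrite {3}/inv /inv /= revK size_rev; apply => //.
  by move=> u _; rewrite /holds /filledB /zrd /= r0.
move=> u s v _ _ oks; split.
  by case: s oks => -[|a w] y /and3P [_ /= pw py]; [case/andP: py|case/andP: pw => /andP []].
rewrite rev_cons map_rcons flatten_rcons rev_cat sapp_cat sapp_cat mulSn.
rewrite -sapp_nseqD; exact: exec_expand.
Qed.

(** On tape 2 the head first crosses the cells of the examples, all erased by now, and only then the
    e2e input. The counter is erased rightwards, which leaves the head of tape 3 on the first random
    bit. *)
Definition clean : machine :=
  mwhile sepC (step3 nop nop (wr Blk MoveR)) ;;
  step3 (mv MoveL) (mv MoveL) nop ;;
  mwhile filledA (step3 (mv MoveL) nop nop) ;;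
  mwhile blankB (step3 nop (mv MoveL) nop) ;;
  mwhile filledB (step3 nop (mv MoveL) nop) ;;
  step3 (mv MoveR) (mv MoveR) nop.

Lemma exec_clean u q v s :
  all (predC is_blk) u -> all (predC is_blk) v -> 0 < size v ->
  exec clean (10 * (size u + q + size v + g.+1))
    ((sapp (rev u) blanks, blanks),
     (sapp (nseq q Blk) (scons Blk (sapp (rev v) blanks)), s), marks g rho)
    ((blanks, sapp u blanks), (blanks, sapp v (sapp (nseq q.+1 Blk) s)), (blanks, rho)).
Proof.
move=> pu pv v0.
pose inv i : ztapes := ((sapp (rev u) blanks, blanks),
  (sapp (nseq q Blk) (scons Blk (sapp (rev v) blanks)), s), marks (g - i) rho).
have loop : exec (mwhile sepC (step3 nop nop (wr Blk MoveR))) (g * 3) (inv 0) (inv g).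
  apply: exec_while_nat => [i lti|]; last by rewrite /inv subnn.
  rewrite /inv; have -> : g - i = (g - i.+1).+1 by lia.
  by split; [|one_step].
rewrite {}/inv subn0 subnn in loop.
eapply exec_le.
  eapply exec_seq; first exact: loop.
  eapply exec_seq; first exact: exec_step3.
  eapply exec_seq.
    by apply: exec_scanA_left => //; rewrite all_rev.
  rewrite sapp_nseqS -[scons Blk (sapp (nseq q Blk) _)]/(sapp (nseq q.+1 Blk) _).
  eapply exec_seq.
    apply: exec_scanB_blank_left.
    case/lastP: v pv v0 {loop} => // v a; rewrite all_rcons rev_rcons => /andP [pa _] _; exact: pa.
  eapply exec_seq.
    by apply: exec_scanB_left => //; rewrite all_rev.
  by one_step; rewrite revK.
rewrite !size_rev; lia.
Qed.

End Main.

(** * The whole transducer and its cost *)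

Arguments spread : simpl never.
Arguments expanded : simpl never.

(** The counter first holds the number of examples to keep, is used up by [cut], and then holds the
    gap [g]. *)
Definition prepare (Kv Kg : nat) : machine :=
  power Kv ;; cut ;; power Kg ;; build ;; transduce ;; clean.

Definition prepare_cost (Kv Kg : nat) : nat := 102 * (Kv.+1 + Kg.+1) + 2000.

Lemma size_expanded g s : size (expanded g s) = (size s.1).+1 * g.+1 + 2.
Proof. by rewrite /expanded size_cat size_spread. Qed.

Lemma expanded_filled g s :
  all is_bit s.1 -> is_bit s.2 -> all (predC is_blk) (expanded g s).
Proof. by move=> p1 /andP [p2 _]; rewrite /expanded all_cat spread_filled //= p2. Qed.

Lemma size_expandeds g n ws : all (sample_ok n) ws ->
  size (flatten (map (expanded g) ws)) = size ws * (n.+1 * g.+1 + 2).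
Proof.
elim: ws => [//|s ws IH] /andP [/and3P [/eqP sz _ _] /IH e].
by rewrite -[flatten _]/(expanded g s ++ _) size_cat e size_expanded sz mulSn.
Qed.

Lemma expandeds_filled g n ws : all (sample_ok n) ws ->
  all (predC is_blk) (flatten (map (expanded g) ws)).
Proof.
elim: ws => [//|s ws IH] /andP [/and3P [_ p1 p2] /IH e].
by rewrite -[flatten _]/(expanded g s ++ _) all_cat e expanded_filled.
Qed.

Lemma exec_prepare (Kv Kg n : nat) x ws rest rho :
  let N := n + 2 in let g := N ^ Kg in
  all is_bit x -> size x = n -> all (sample_ok n) ws -> size ws = N ^ Kv ->
  ~~ is_sep (rho 0) ->
  exec (prepare Kv Kg) (prepare_cost Kv Kg * N ^ (Kv + Kg + 2))
    ((blanks, sapp x blanks), (blanks, sapp (flatten (map raw ws)) rest), (blanks, rho))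
    ((blanks, sapp (flatten (map (expanded g) ws)) blanks),
     (blanks, sapp (content g x) (sapp (nseq (N ^ Kv * N).+1 Blk) (scons Blk (stail rest)))),
     (blanks, rho)).
Proof.
move=> N g px sx ok sws rho0.
have N0 : 0 < N by rewrite /N addn2.
have V0 : 0 < N ^ Kv by rewrite expn_gt0 N0.
have g0 : 0 < g by rewrite expn_gt0 N0.
(* [power] needs a first symbol other than [Sep] on tape 2: there is at least one example, and it
   starts with a bit or, when [n = 0], with its label. *)
have first s : ~~ is_sep (sapp (flatten (map raw ws)) s 0).
  case: ws ok sws => [|[[|a w] y] ws] /=; first by move=> _ H; rewrite -H in V0.
    by case/andP => /and3P [_ _ /andP []].
  by case/andP => /and3P [_ /andP [/andP []]].
eapply exec_le.
  eapply exec_seq; first exact: (exec_power rho0 Kv px).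
  rewrite sx -/N -sws.
  eapply exec_seq; first exact: (exec_cut _ _ _ ok).
  eapply exec_seq; first exact: (exec_power rho0 Kg px).
  rewrite sx -/N -/g.
  eapply exec_seq; first exact: (exec_build rho0 g _ px).
  eapply exec_seq.
    by apply: (exec_transduce rho0 g _ _ ok).
  rewrite -[sapp (rev _) blanks]/(sapp _ blanks).
  apply: (@exec_clean rho rho0 g).
  - exact: expandeds_filled ok.
  - exact: content_filled.
  - by rewrite size_content; lia.
rewrite sws size_content (size_expandeds _ ok) sws sx -!/N.
have -> : Kv + Kg + 2 = (Kv + Kg).+2 by lia.
rewrite /prepare_cost !expnS !expnD -/g.
move: (N ^ Kv) V0 => V V0; move: g g0 {first} => g g0.
have Nn : n.+2 = N by rewrite /N addn2.
have -> : n.+1 = N.-1 by lia.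
have -> : n + 3 = N.+1 by lia.
have -> : 2 * n + 4 = 2 * N by lia.
(* Every cost is a bounded multiple of [W], up to the factors [Kv.+1] and [Kg.+1]. The products are
   bounded one at a time and then treated as atoms, so that the final inequality is linear. *)
set W := N * (N * (V * g)).
have NVg : N * (V * g) <= W by rewrite /W; nia.
have NV : N * V <= N * (V * g) by nia.
have Ng : N * g <= N * (V * g) by nia.
have W0 : 0 < W by rewrite /W !muln_gt0 N0 V0 g0.
have -> : (102 * (Kv.+1 + Kg.+1) + 2000) * W = 102 * (Kv.+1 * W) + 102 * (Kg.+1 * W) + 2000 * W by lia.
have ha : Kv.+1 * (N * V) <= Kv.+1 * W by rewrite leq_mul2l; lia.
have hc : Kg.+1 * (N * g) <= Kg.+1 * W by rewrite leq_mul2l; lia.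
move: (Kv.+1 * (N * V)) (Kv.+1 * W) (Kg.+1 * (N * g)) (Kg.+1 * W) ha hc => a a' c c' ha hc.
have N2 : 2 <= N by lia.
have hb : V.+1 * N.+1 <= 4 * (N * V) by nia.
have hd : N * g.+2 <= 3 * (N * g) by nia.
have he : V * (100 * (N * g.+2)).+2 <= 302 * (N * (V * g)).
  have : V * (N * g.+2) <= V * (3 * (N * g)) by rewrite leq_mul2l hd orbT.
  nia.
have hf : V * (N.-1 * g.+1 + 2) <= 2 * (N * (V * g)) + 2 * (N * V).
  have : N.-1 * g.+1 <= 2 * (N * g) by nia.
  nia.
have hg : N * g.+1 <= 2 * (N * g) by nia.
have hv : V <= N * V by nia.
have hg' : g <= N * g by nia.
move: W NVg W0 => W NVg W0; lia.
Qed.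

(** * The circuit learner and its simulation of the e2e learner *)

Definition report : machine :=
  mact (fun a b c => ((if b is S1 then S1 else S0, Stay), keep b, keep c)).

(** The swapped machine leaves its output under the head of tape 2, whereas [out_bit] reads tape 1;
    [report] transfers it. *)
Definition learner (M : TM) (Kv Kg : nat) : TM :=
  to_TM (prepare Kv Kg ;; swapped M ;; report).

Definition phi (g : nat) (x : seq bool) : seq bool := spread false g (true :: x).

Lemma enc_phi g x : enc_bits (phi g x) = spread S0 g (S1 :: enc_bits x).
Proof.
rewrite /phi /spread /enc_bits map_flatten -!map_comp -[S1 :: _]/(map sym_of_bool (true :: x)).
rewrite -map_comp; congr flatten; apply: eq_map => b.
by rewrite /= map_nseq.
Qed.

Lemma size_phi g x : size (phi g x) = (size x).+1 * g.+1.
Proof. exact: size_spread. Qed.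

Lemma enc_bits_bit x : all is_bit (enc_bits x).
Proof. by rewrite /enc_bits all_map; apply/allP => -[]. Qed.

Definition enc_pair (s : seq bool * bool) : seq sym * sym := (enc_bits s.1, sym_of_bool s.2).

Lemma enc_samplesE S : enc_samples S = flatten (map raw (map enc_pair S)).
Proof. by rewrite /enc_samples -map_comp. Qed.

Lemma enc_samples_phi g S :
  enc_samples [seq (phi g s.1, s.2) | s <- S] = flatten (map (expanded g) (map enc_pair S)).
Proof.
rewrite /enc_samples -!map_comp; congr flatten; apply: eq_map => s.
exact: (congr1 (cat^~ [:: sym_of_bool s.2; Sep]) (enc_phi g s.1)).
Qed.

Lemma enc_pair_ok n S :
  all (fun s => size s.1 == n) S -> all (sample_ok n) (map enc_pair S).
Proof.
rewrite all_map; apply: sub_all => s /= /eqP sz.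
by rewrite /sample_ok /= size_map sz eqxx enc_bits_bit; case: s.2.
Qed.

Lemma content_e2e_input g x :
  content g (enc_bits x) = e2e_input ((size x + 2) * g.+1) g.+1 (phi g x).
Proof. by rewrite /content /e2e_input enc_phi size_map. Qed.

Lemma sapp_ge l s i : size l <= i -> sapp l s i = s (i - size l).
Proof.
by elim: l i => [|a l IH] [|i] //= lei; apply: IH.
Qed.

Lemma sapp_prefix l l' s s' i : i < size l -> sapp (l ++ l') s i = sapp l s' i.
Proof. by move=> lti; rewrite sapp_cat !sapp_lt. Qed.

Lemma run_learner (M : TM) (Kv Kg n t m : nat) x S r c' :
  let N := n + 2 in let g := N ^ Kg in
  size x = n -> all (fun s => size s.1 == n) S ->
  t < N ^ Kv -> N ^ Kv <= size S -> t < size r ->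
  prepare_cost Kv Kg * N ^ (Kv + Kg + 2) + t + 10 <= m ->
  run t (@init M (e2e_input (N * g.+1) g.+1 (phi g x))
     (take t.+1 [seq (phi g s.1, s.2) | s <- S]) (take t.+1 r)) = Some c' ->
  exists2 c'', run m (@init (learner M Kv Kg) (circ_input x) S r) = Some c'' &
     out_bit (Some c'') = out_bit (Some c').
Proof.
move=> N g sx okS ltV leS ltr fuel runM.
set V := N ^ Kv in ltV leS.
pose rho := sapp (enc_bits r) blanks.
have rho0 : ~~ is_sep (rho 0) by rewrite /rho; case: r ltr {rho runM} => // -[].
pose ws := map enc_pair (take V S).
have okV : all (fun s => size s.1 == n) (take V S).
  by move: okS; rewrite -{1}(cat_take_drop V S) all_cat => /andP [].
have okw := enc_pair_ok okV.
have sw : size ws = V by rewrite size_map size_take_min; lia.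
have sxe : size (enc_bits x) = n by rewrite size_map.
pose rest := sapp (enc_samples (drop V S)) blanks.
have prep := @exec_prepare Kv Kg n _ ws rest rho (enc_bits_bit x) sxe okw sw rho0.
rewrite -/N -/g -/V in prep; set z1 := (X in exec _ _ _ X) in prep.
(* The first [t.+1] expanded examples already occupy more than [t] cells. *)
have agA : zagree t (zview (tape_of (enc_samples (take t.+1 [seq (phi g s.1, s.2) | s <- S])))) z1.1.1.
  rewrite zview_tape_of -map_take enc_samples_phi /z1 /ws => i lei; split => //=.
  have -> : take V S = take t.+1 S ++ take (V - t.+1) (drop t.+1 S).
    by rewrite -takeD subnKC.
  rewrite !map_cat flatten_cat; apply/esym; apply: sapp_prefix.
  have ok1 : all (fun s => size s.1 == n) (take t.+1 S).
    by move: okS; rewrite -{1}(cat_take_drop t.+1 S) all_cat => /andP [].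
  rewrite (size_expandeds _ (enc_pair_ok ok1)) size_map size_take_min; nia.
(* To the right of the e2e input, the erased examples provide more than [V * N > t] blanks before
   any leftover symbol. *)
have agB : zagree t (zview (tape_of (e2e_input (N * g.+1) g.+1 (phi g x)))) z1.1.2.
  rewrite zview_tape_of /z1 content_e2e_input sx -/N => i lei; split; first by [].
  move: (e2e_input _ _ _) => w /=; case: (ltnP i (size w)) => lti.
    by rewrite !sapp_lt.
  rewrite !sapp_ge // -[scons Blk (sapp _ _)]/(sapp (nseq (V * N).+1 Blk) _) sapp_lt.
    by rewrite nth_nseq if_same.
  rewrite size_nseq; have : 0 < N by rewrite /N addn2.
  nia.
have agC : zagree t (zview (tape_of (enc_bits (take t.+1 r)))) z1.2.
  rewrite zview_tape_of /z1 /rho => i lei; split => //=.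
  rewrite -{2}(cat_take_drop t.+1 r) /enc_bits map_cat; apply/esym; apply: sapp_prefix.
  by rewrite size_map size_take_min; lia.
have [z2 runz out] := mrun_swapped runM (leqnn t) agB agA agC.
have execM : exec (swapped M) t z1 z2 by [].
have execO : exec report 1 z2
    (zact ((if zrd z2.1.2 is S1 then S1 else S0), Stay) z2.1.1, z2.1.2, z2.2).
  by case: (z2) => [[za zb] zc]; rewrite /exec /= !zact_keep.
have bound : (prepare_cost Kv Kg * N ^ (Kv + Kg + 2) + (t + 1).+1).+1
    <= m by apply: leq_trans fuel; lia.
have := exec_le (exec_seq prep (exec_seq execM execO)) bound; rewrite /exec.
set c0 := @init (learner M Kv Kg) (circ_input x) S r.
have -> : ((blanks, sapp (enc_bits x) blanks), (blanks, sapp (flatten (map raw ws)) rest),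
    (blanks, rho)) = zviews c0.
  rewrite /zviews /c0 /= !zview_tape_of /rho /rest -sapp_cat !enc_samplesE.
  by rewrite -flatten_cat -map_cat -map_cat cat_take_drop.
move=> /(@run_to_TM (prepare Kv Kg ;; swapped M ;; report) _ c0) [c'' runc vc].
exists c'' => //.
have := congr1 (fun z => zrd z.1.1) vc.
rewrite -[LHS]/(zrd (zview (tp1 c''))) zrd_zview /out_bit => ->.
by rewrite -out /zrd /=; case: (z2.1.2.2 0).
Qed.

(** * Circuits as autoregressive linear generators *)
Local Open Scope ring_scope.
Local Notation R := Rdefinitions.R.

Definition bitR (b : bool) : R := (b : nat)%:R.

(** When the context fits in the window, [Om o] is the weight of the token at distance [o] before
    the position being generated. *)
Lemma lin_gen_offset d (Om : nat -> R) (b : R) (x : seq bool) : (size x <= d)%N ->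
  lin_gen (fun i : 'I_d => Om (d - i)%N) b x =
  (0 <= \sum_(u < size x) Om (size x - u)%N * bitR (nth false x u) + b).
Proof.
move=> lexd; rewrite /lin_gen; congr (0 <= _ + b).
transitivity (\sum_(i < size x) Om i.+1 * bitR (nth false x (size x - i.+1))).
  rewrite (big_ord_widen d (fun i => Om i.+1 * bitR (nth false x (size x - i.+1)))) //.
  apply: eq_bigr => i _; congr (Om _ * _) => /=; have := ltn_ord i; lia.
rewrite (reindex_inj rev_ord_inj); apply: eq_bigr => i _ /=; have := ltn_ord i.
move=> lti; congr (Om _ * bitR (nth _ _ _)); lia.
Qed.

Lemma sum_spread g (F : nat -> R) x :
  \sum_(u < size x * g.+1) F u * bitR (nth false (spread false g x) u) =
  \sum_(j < size x) F (j * g.+1)%N * bitR (nth false x j).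
Proof.
elim: x F => [|a x IH] F; first by rewrite /= mul0n !big_ord0.
rewrite [size _]/= mulSn big_split_ord /= big_ord_recl [RHS]big_ord_recl /=.
rewrite big1 ?addr0; last first.
  move=> i _; rewrite nth_cat size_nseq ltn_ord nth_nseq ltn_ord.
  by rewrite /bitR mulr0.
congr (_ + _); have := IH (fun u => F (g.+1 + u)%N) => /= <-.
apply: eq_bigr => i _; rewrite nth_cat size_nseq.
have -> : (g + i < g)%N = false by lia.
by rewrite addKn.
Qed.

Section Embedding.
Variables (C : circuit) (g : nat).
Let s := cs C.
Let n := cn C.
Hypotheses (s_gt0 : (0 < s)%N) (g_ge : (s ^ 3 <= g)%N).

(* A Sidon set: the times of two gates determine the pair of gates from their difference. *)
Let u (k : nat) : nat := (k * (s * s + 1) + k * k)%N.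
(** The shift puts the output gate at time [g], the last of the [g.+1] generated tokens. *)
Definition gate_time (k : nat) : nat := (g - u s.-1 + u k)%N.
Local Notation tau := gate_time.

(** The left side equals [(s - 1) * s * (s + 1) = s^3 - s]. *)
Lemma u_last : (u s.-1 <= g)%N.
Proof. apply: leq_trans g_ge; rewrite /u !expnS expn0; case: s s_gt0 => // p _ /=; nia. Qed.

Lemma u_mono k l : (l < k)%N -> (u l < u k)%N.
Proof. by rewrite /u; nia. Qed.

Lemma tau_last : tau s.-1 = g.
Proof. by rewrite /gate_time subnK // u_last. Qed.

Lemma tau_lt k l : (tau l < tau k)%N = (l < k)%N.
Proof.
rewrite /gate_time ltn_add2l; case: (ltngtP l k) => [lt|lt|->]; last by rewrite ltnn.
  by rewrite u_mono.
by have := u_mono lt; lia.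
Qed.

Lemma tau_inj : injective tau.
Proof. by move=> k l e; have := tau_lt k l; have := tau_lt l k; rewrite e !ltnn; lia. Qed.

(** For [k = l + p.+1] the left side is [k^2 - l^2], so it can serve as a remainder modulo
    [s^2 + 1]. *)
Lemma u_gap l p : (l + p.+1 < s)%N -> (p.+1 * (2 * l + p.+1) < s * s + 1)%N.
Proof.
move=> h; have : ((l + p.+1) * (l + p.+1) <= s * s)%N by rewrite leq_mul // ltnW.
by clear; nia.
Qed.

(** The difference is [(k - l) * (s^2 + 1) + (k^2 - l^2)]: its quotient by [s^2 + 1] gives [k - l],
    and its remainder then gives [k + l]. *)
Lemma tau_sidon k l k' l' : (l < k < s)%N -> (l' < k' < s)%N ->
  (tau k - tau l)%N = (tau k' - tau l')%N -> k = k' /\ l = l'.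
Proof.
move=> /andP [lk ks] /andP [lk' ks'].
have := u_mono lk; have := u_mono lk'; rewrite /gate_time /u => h1 h2 e.
have [p kE] : exists p, k = (l + p.+1)%N by exists (k - l.+1)%N; lia.
have [p' kE'] : exists p, k' = (l' + p.+1)%N by exists (k' - l'.+1)%N; lia.
subst k k'.
have E : (p.+1 * (s * s + 1) + p.+1 * (2 * l + p.+1) = p'.+1 * (s * s + 1) + p'.+1 * (2 * l' + p'.+1))%N by nia.
have B := u_gap ks; have B' := u_gap ks'.
have pp : p = p'.
  case: (ltngtP p p') => // lt; exfalso.
    have : (p.+2 * (s * s + 1) <= p'.+1 * (s * s + 1))%N by rewrite leq_mul2r; lia.
    by move: E B B' {e h1 h2}; lia.
  have : (p'.+2 * (s * s + 1) <= p.+1 * (s * s + 1))%N by rewrite leq_mul2r; lia.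
  by move: E B B' {e h1 h2}; lia.
subst p'; have : (p.+1 * (2 * l + p.+1) = p.+1 * (2 * l' + p.+1))%N by lia.
by move/eqP; rewrite eqn_mul2l /= => /eqP; lia.
Qed.

Definition gate_at (t : nat) : option 'I_s := [pick k : 'I_s | tau k == t].

Lemma gate_at_tau (k : 'I_s) : gate_at (tau k) = Some k.
Proof.
rewrite /gate_at; case: pickP => [l /eqP /tau_inj /val_inj -> //|/(_ k)].
by rewrite eqxx.
Qed.

(** By [tau_sidon] at most one pair of gates lies at a given distance, so [pick] has no real
    choice. *)
Definition gate_weight (o : nat) : R :=
  if [pick p : 'I_s * 'I_s | (p.2 < p.1)%N && (tau p.1 - tau p.2 == o)%N] is Some p
  then if eg C p.1 p.2 then wg C p.1 p.2 else 0 else 0.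

Lemma gate_weight_tau (k l : 'I_s) : (l < k)%N ->
  gate_weight (tau k - tau l) = if eg C k l then wg C k l else 0.
Proof.
move=> lk; rewrite /gate_weight; case: pickP => [[k' l'] /= /andP [lk' /eqP e]|/(_ (k, l))].
  have [||/val_inj -> /val_inj -> //] := tau_sidon _ _ e; by rewrite ?lk ?lk' ltn_ord.
by rewrite /= lk eqxx.
Qed.

(* At a time without gate, the weight of the leading 1 outweighs all the gates. *)
Definition input_weight (q t : nat) : R :=
  if gate_at t is Some k
  then if q == n.+1 then 0 else if ein C k (n - q) then win C k (n - q) else 0
  else if q == n.+1 then - (1 + \sum_(v < t) `|gate_weight (t - v)|) else 0.

(** Distances up to [g] serve for pairs of generated tokens. A larger one is [q * g.+1 + t], from
    time [t] back to the start of the [q]-th block from the end of the prompt: [q = n.+1] is the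
    leading 1, and bit [j] of [x] has [q = n - j]. Padding zeros contribute nothing at any
    distance. *)
Definition offset_weight (o : nat) : R :=
  if (o < g.+1)%N then gate_weight o else input_weight (o %/ g.+1) (o %% g.+1).

Variable x : seq bool.
Hypothesis sx : size x = n.

Definition tape_bit (t : nat) : bool :=
  if gate_at t is Some k then nth false (gate_vals C x s) k else false.

Lemma size_gate_vals k : size (gate_vals C x k) = k.
Proof. by elim: k => //= k IH; rewrite size_rcons IH. Qed.

Lemma nth_gate_vals k m j : (j < k <= m)%N ->
  nth false (gate_vals C x m) j = nth false (gate_vals C x k) j.
Proof.
case/andP=> jk; elim: m => [|m IH]; first by rewrite leqn0 => /eqP ->.
rewrite leq_eqVlt => /orP [/eqP -> //|km].
by rewrite /= nth_rcons size_gate_vals (leq_trans jk km) IH.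
Qed.

Lemma nth_gate_val k m : (k < m)%N ->
  nth false (gate_vals C x m) k = gate_val C x (gate_vals C x k) k.
Proof.
move=> km; rewrite (@nth_gate_vals k.+1) ?ltnS ?leqnn //.
by rewrite /= nth_rcons size_gate_vals ltnn eqxx.
Qed.

Lemma tape_bit_sum t :
  bitR (tape_bit t) =
  \sum_(l < s) (if tau l == t then bitR (nth false (gate_vals C x s) l) else 0).
Proof.
rewrite /tape_bit /gate_at; case: pickP => [k /eqP e|e].
  rewrite (bigD1 k) //= e eqxx big1 ?addr0 // => l nlk; case: eqP => // e'.
  by case/eqP: nlk; apply/val_inj/tau_inj; rewrite e e'.
by rewrite big1 // => l _; rewrite e.
Qed.

Lemma input_sum t : (t < g.+1)%N ->
  \sum_(v < n.+1 * g.+1) offset_weight (n.+1 * g.+1 + t - v) * bitR (nth false (phi g x) v) =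
  input_weight n.+1 t + \sum_(j < n) input_weight (n - j) t * bitR (nth false x j).
Proof.
move=> ltt.
have := sum_spread g (fun v => offset_weight (n.+1 * g.+1 + t - v)) (true :: x).
rewrite /= sx -/n => ->.
have E q : (0 < q)%N -> offset_weight (q * g.+1 + t) = input_weight q t.
  move=> q0; rewrite /offset_weight; have -> : (q * g.+1 + t < g.+1)%N = false by nia.
  by rewrite divnMDl // modnMDl divn_small // addn0 modn_small.
rewrite big_ord_recl /= mul0n subn0 E // mulr1; congr (_ + _).
apply: eq_bigr => j _; rewrite -E; last by rewrite subn_gt0.
congr (offset_weight _ * _); rewrite /bump /=; have := ltn_ord j; nia.
Qed.

(** Only the times [tau l] carry a nonzero token, so after exchanging the sums each gate [l] before
    [k] contributes one term, with the weight of the edge from [l] to [k]. *)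
Lemma gate_sum (k : 'I_s) :
  \sum_(v < tau k) gate_weight (tau k - v) * bitR (tape_bit v) =
  \sum_(l < k | eg C k l) wg C k l * bitR (nth false (gate_vals C x k) l).
Proof.
under eq_bigr => v _ do rewrite tape_bit_sum mulr_sumr.
rewrite exchange_big /=.
pose F l := if eg C k l then wg C k l * bitR (nth false (gate_vals C x k) l) else 0.
transitivity (\sum_(l < s | (l < k)%N) F l); last first.
  by rewrite -(big_ord_widen _ F (ltnW (ltn_ord k))) [RHS]big_mkcond.
rewrite [RHS]big_mkcond; apply: eq_bigr => l _; rewrite -tau_lt; case: ifP => lt.
  rewrite (bigD1 (Ordinal lt)) //= eqxx big1 ?addr0; last first.
    move=> v nv; case: eqP => [e|]; last by rewrite mulr0.
    by case/eqP: nv; apply: val_inj.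
  rewrite tau_lt in lt; rewrite gate_weight_tau // /F (@nth_gate_vals k s) ?lt ?(ltnW (ltn_ord k)) //.
  by case: ifP => // _; rewrite mul0r.
rewrite big1 // => v _; case: eqP => [e|]; last by rewrite mulr0.
by move: lt; rewrite e ltn_ord.
Qed.

Lemma generator_step t : (t < g.+1)%N ->
  lin_gen (fun i : 'I_((n + 2) * g.+1) => offset_weight ((n + 2) * g.+1 - i)) 0
    (phi g x ++ mkseq tape_bit t) = tape_bit t.
Proof.
move=> ltt.
have sz : size (phi g x ++ mkseq tape_bit t) = (n.+1 * g.+1 + t)%N.
  by rewrite size_cat size_mkseq size_phi sx.
rewrite lin_gen_offset ?sz; last by nia.
rewrite addr0 big_split_ord /=.
have -> : \sum_(i < n.+1 * g.+1) offset_weight (n.+1 * g.+1 + t - i)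
      * bitR (nth false (phi g x ++ mkseq tape_bit t) i) =
    input_weight n.+1 t + \sum_(j < n) input_weight (n - j) t * bitR (nth false x j).
  rewrite -input_sum //; apply: eq_bigr => i _.
  by rewrite nth_cat size_phi sx ltn_ord.
have -> : \sum_(i < t) offset_weight (n.+1 * g.+1 + t - (n.+1 * g.+1 + i))
      * bitR (nth false (phi g x ++ mkseq tape_bit t) (n.+1 * g.+1 + i)) =
    \sum_(v < t) gate_weight (t - v) * bitR (tape_bit v).
  apply: eq_bigr => i _; rewrite nth_cat size_phi sx.
  have -> : (n.+1 * g.+1 + i < n.+1 * g.+1)%N = false by lia.
  rewrite subnDl addKn nth_mkseq // /offset_weight.
  by have -> : (t - i < g.+1)%N by lia.
rewrite {2}/tape_bit; rewrite /input_weight; case E: (gate_at t) => [k|].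
  (* At the time of gate [k] the clock has weight 0, and the two sums are those of [gate_val]. *)
  have tk : t = tau k by move: E; rewrite /gate_at; case: pickP => // l /eqP <- [->].
  subst t; rewrite eqxx add0r gate_sum nth_gate_val // /gate_val; congr (0 <= _ + _).
  rewrite [RHS]big_mkcond; apply: eq_bigr => j _.
  have -> : (n - j == n.+1)%N = false by have := ltn_ord j; lia.
  rewrite subKn; last exact/ltnW.
  by case: ifP => // _; rewrite mul0r.
(* At an idle time only the clock and the earlier tokens count. The latter add at most the sum of
   the absolute weights, so the total is at most -1. *)
rewrite eqxx [\sum_(j < n) _]big1 ?addr0; last first.
  move=> j _. have -> : (n - j == n.+1)%N = false by have := ltn_ord j; lia.
  by rewrite mul0r.
apply/negbTE; rewrite -ltNge opprD -addrA addrC.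
rewrite -ltrBrDr sub0r opprK.
apply: (le_lt_trans (y := 0)) => //.
rewrite addrC subr_le0.
apply: ler_sum => v _; rewrite /bitR; case: (tape_bit v); last by rewrite mulr0.
by rewrite mulr1 ler_norm.
Qed.

Lemma generator_cot t : (t <= g.+1)%N ->
  cot (lin_gen (fun i : 'I_((n + 2) * g.+1) => offset_weight ((n + 2) * g.+1 - i)) 0)
    t (phi g x) = phi g x ++ mkseq tape_bit t.
Proof.
elim: t => [|t IH] lt; first by rewrite cats0.
rewrite /cot iterS -/(cot _ _ _) IH; last exact: ltnW.
rewrite /bar generator_step // -cats1 -catA; congr (_ ++ _).
by rewrite /mkseq -addn1 iotaD map_cat.
Qed.

End Embedding.

Lemma circuit_as_generator (C : circuit) (g : nat) :
  (0 < cs C)%N -> (cs C ^ 3 <= g)%N ->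
  exists (w : 'I_((cn C + 2) * g.+1) -> R) (b : R), forall x, size x = cn C ->
    e2e (lin_gen w b) g.+1 (phi g x) = circ_eval C x.
Proof.
move=> s0 gs; exists (fun i => offset_weight C g ((cn C + 2) * g.+1 - i)), 0 => x sx.
rewrite /e2e (generator_cot s0 gs sx) // /mkseq -addn1 iotaD map_cat catA /= cats1 last_rcons.
have ls : ((cs C).-1 < cs C)%N by rewrite prednK.
have := gate_at_tau s0 gs (Ordinal ls); rewrite /= (tau_last s0 gs) /tape_bit => ->.
by rewrite /circ_eval -nth_last size_gate_vals.
Qed.

(** * Pushing the distribution forward *)

Section Pushforward.
Variables (X Y : finType) (h : X -> Y) (D : X -> R).
Hypothesis D1 : \sum_x D x = 1.

Definition push (y : Y) : R := \sum_(x | h x == y) D x.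

Lemma push_sum (Q : pred Y) : \sum_(y | Q y) push y = \sum_(x | Q (h x)) D x.
Proof.
rewrite [RHS](partition_big h Q) //; apply: eq_bigr => y Qy; apply: eq_bigl => x.
by case: eqP => [->|]; rewrite ?Qy ?andbF.
Qed.

Definition restrict a b (le_ab : (a <= b)%N) (s : {ffun 'I_b -> X}) : {ffun 'I_a -> Y} :=
  [ffun i => h (s (widen_ord le_ab i))].

(** The coordinates from [a] on are independent of the rest and sum to 1; each of the others is
    pushed forward separately. *)
Lemma sum_restrict a b (le_ab : (a <= b)%N) (F : {ffun 'I_a -> Y} -> R) :
  \sum_(s : {ffun 'I_b -> X}) (\prod_i D (s i)) * F (restrict le_ab s) =
  \sum_(s : {ffun 'I_a -> Y}) (\prod_i push (s i)) * F s.
Proof.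
rewrite (partition_big (restrict le_ab) xpredT) //=; apply: eq_bigr => s' _.
transitivity ((\sum_(s | restrict le_ab s == s') \prod_i D (s i)) * F s').
  by rewrite mulr_suml; apply: eq_bigr => s /eqP ->.
congr (_ * _).
(* The fibre over [s'] is a product of conditions on single coordinates, void from [a] on, so the
   sum over it factors. *)
pose Q (i : 'I_b) : pred X := fun x =>
  if insub (i : nat) is Some j then h x == s' j else true.
have EQ s : (restrict le_ab s == s') = (s \in family Q).
  apply/eqP/familyP => [e i|Hs].
    rewrite unfold_in /Q; case: insubP => // j _ ej; rewrite -e ffunE.
    by apply/eqP; congr (h (s _)); apply: val_inj.
  apply/ffunP => j; rewrite ffunE; have := Hs (widen_ord le_ab j).
  by rewrite unfold_in /Q /= valK => /eqP.
rewrite (eq_bigl _ _ EQ) -(bigA_distr_big_dep _ (fun _ x => D x)).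
pose G (i : nat) := if insub i is Some j then push (s' j) else 1.
transitivity (\prod_(i < b) G i).
  apply: eq_bigr => i _; rewrite /G /Q; case: insubP => [j _ _|_] //.
transitivity (\prod_(i < b | (i < a)%N) G i).
  rewrite [RHS]big_mkcond; apply: eq_bigr => i _; case: ifP => // ia.
  by rewrite /G insubF.
rewrite -(big_ord_widen b G le_ab); apply: eq_bigr => i _.
by rewrite /G valK.
Qed.

End Pushforward.

(** Uniform bits are a product of fair coins, so this is [sum_restrict] for the identity on
    [bool]. *)
Lemma sum_take_bits a b (le_ab : (a <= b)%N) (F : seq bool -> R) :
  \sum_(r : b.-tuple bool) 2%:R ^- b * F (take a r) =
  \sum_(r : a.-tuple bool) 2%:R ^- a * F r.
Proof.
have half : \sum_(x : bool) (2%:R^-1 : R) = 1.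
  by rewrite big_bool [RHS]splitr !div1r.
have := sum_restrict id half le_ab (fun s => F (tuple_of_finfun s)).
have E m (K : m.-tuple bool -> R) :
    \sum_(r : m.-tuple bool) K r = \sum_(s : {ffun 'I_m -> bool}) K (tuple_of_finfun s).
  rewrite (reindex (@tuple_of_finfun bool m)) //.
  by exists (@finfun_of_tuple bool m) => s _; [apply: tuple_of_finfunK|apply: finfun_of_tupleK].
rewrite !E => H; transitivity (\sum_(s : {ffun 'I_b -> bool}) (\prod_(i < b) 2%:R^-1) *
    F (tuple_of_finfun (restrict id le_ab s))).
  apply: eq_bigr => s _; rewrite prodr_const card_ord exprVn; congr (_ * F _).
  apply: (@eq_from_nth _ false) => [|i]; first by rewrite size_take_min !size_tuple; apply/minn_idPl.
  rewrite size_take_min size_tuple (minn_idPl le_ab) => ia.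
  rewrite nth_take // -(tnth_nth _ _ (widen_ord le_ab (Ordinal ia))).
  by rewrite -(tnth_nth _ _ (Ordinal ia)) !tnth_mktuple ffunE.
rewrite H; apply: eq_bigr => s _; congr (_ * _).
under eq_bigr => i _.
  rewrite /push big_pred1_eq.
  over.
by rewrite prodr_const card_ord exprVn.
Qed.

Lemma phi_tupleP g n (x : n.-tuple bool) : size (phi g x) == (n.+1 * g.+1)%N.
Proof. by rewrite size_phi size_tuple. Qed.
Definition phi_tuple g n (x : n.-tuple bool) : (n.+1 * g.+1).-tuple bool :=
  Tuple (phi_tupleP g x).

Lemma is_distr_push g n (D : n.-tuple bool -> R) :
  is_distr D -> is_distr (push (@phi_tuple g n) D).
Proof.
case=> D0 D1; split=> [y|]; first by apply: sumr_ge0.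
by rewrite (push_sum _ _ xpredT).
Qed.

Lemma take_ffun_samples (A : Type) a b (le_ab : (a.+1 <= b.+1)%N) (F : 'I_b.+1 -> A) :
  take a.+1 [seq F i | i <- enum 'I_b.+1] = [seq F (widen_ord le_ab i) | i <- enum 'I_a.+1].
Proof.
pose x0 := F ord0.
apply: (@eq_from_nth _ x0) => [|i].
  by rewrite size_take_min 2!size_map !size_enum_ord; apply/minn_idPl.
rewrite size_take_min size_map size_enum_ord (minn_idPl le_ab) => ia.
have ib := leq_trans ia le_ab.
rewrite nth_take // (nth_map ord0) ?size_enum_ord // (nth_map ord0) ?size_enum_ord //.
congr F; apply: val_inj; rewrite /= !nth_enum_ord //.
Qed.

(** Surplus examples and coins are summed out, and the error of a hypothesis under the pushed
    distribution is the error under [D] of its composition with [phi]. *)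
Lemma succ_prob_push (M M' : TM) (t t' n g : nat) w w' (f f' : seq bool -> bool)
    (D : n.-tuple bool -> R) eps (le_tt : (t.+1 <= t'.+1)%N) :
  is_distr D ->
  (forall (s : {ffun 'I_t'.+1 -> n.-tuple bool}) (r : t'.+1.-tuple bool) (x : n.-tuple bool)
      (r' : t.+1.-tuple bool), take t.+1 r = r' :> seq bool ->
    @hyp M' t' n w' f' s r x =
    @hyp M t (n.+1 * g.+1) w f (restrict (@phi_tuple g n) le_tt s) r' (phi g x)) ->
  (forall x : n.-tuple bool, f (phi g x) = f' x) ->
  @succ_prob M' t' n w' f' D eps =
  @succ_prob M t (n.+1 * g.+1) w f (push (@phi_tuple g n) D) eps.
Proof.
move=> [D0 D1] Hhyp Hf; rewrite /succ_prob.
(* [F] takes a plain list, as [sum_take_bits] requires; the default tuple is never reached, because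
   the lists have length [t.+1]. *)
pose F (s : {ffun 'I_t.+1 -> (n.+1 * g.+1).-tuple bool}) (r : seq bool) : R :=
  if @hyp_err M t _ w f (push (@phi_tuple g n) D) s (insubd (nseq_tuple t.+1 false) r) <= eps
  then 1 else 0.
pose K s := \sum_(r : t.+1.-tuple bool) 2%:R ^- t.+1 * F s r.
transitivity (\sum_(s : {ffun 'I_t'.+1 -> n.-tuple bool}) (\prod_i D (s i)) *
   K (restrict (@phi_tuple g n) le_tt s)).
  apply: eq_bigr => s _; rewrite /K -(sum_take_bits le_tt) mulr_sumr; apply: eq_bigr => r _.
  rewrite -mulrA; congr (_ * (_ * _)); rewrite /F; congr (if _ <= _ then _ else _).
  have sr : size (take t.+1 r) == t.+1.
    by rewrite size_take_min size_tuple (minn_idPl le_tt).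
  rewrite /hyp_err push_sum; apply: eq_bigl => x.
  rewrite Hf (Hhyp s r x (insubd (nseq_tuple t.+1 false) (take t.+1 r))) //.
  by rewrite val_insubd sr.
rewrite sum_restrict //; apply: eq_bigr => s _; rewrite /K mulr_sumr; apply: eq_bigr => r _.
by rewrite /F valKd mulrA.
Qed.

(** * The reduction *)

Lemma leq_expl m n e : (m <= n)%N -> (m ^ e <= n ^ e)%N.
Proof. by case: e => // e; rewrite leq_exp2r. Qed.

(** With [A] the sum of the absolute coefficients, [p] is at most [A * N ^ size p] for [N = n + 2],
    and [A < 2 ^ A <= N ^ A]. *)
Lemma poly_le_power (p : {poly int}) :
  exists K, forall n s : nat, s%:Z <= p.[n%:Z] -> (s <= (n + 2) ^ K)%N.
Proof.
pose A := (\sum_(i < size p) absz (p`_i)%R)%N.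
exists (A + size p)%N => n s les.
have N2 : (2 <= n + 2)%N by lia.
have bound : p.[n%:Z] <= (A * (n + 2) ^ size p)%N%:Z.
  rewrite horner_coef /A big_distrl /= -[X in _ <= X]natz natr_sum.
  apply: ler_sum => i _; apply: le_trans (ler_norm _) _.
  rewrite normrM natz PoszM -abszE ler_wpM2l // ger0_norm; last by rewrite exprn_ge0.
  rewrite -!natz -natrX ler_nat; apply: (@leq_trans ((n + 2) ^ i)%N).
    by apply: leq_expl; lia.
  by rewrite leq_exp2l // ltnW.
have := le_trans les bound; rewrite lez_nat => /leq_trans; apply.
rewrite expnD leq_mul2r; apply/orP; right.
apply: (leq_trans (ltnW (ltn_expl A (isT : (1 < 2)%N)))).
exact: leq_expl.
Qed.

(** The sum of [d], [T], the new input length and 1 is at most [8 * g * N <= g * N ^ 4], and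
    [c < N ^ c]. The time thus falls below a power of [N], which the learner can count. *)
Lemma e2e_time_le (c k Kg n : nat) (N := (n + 2)%N) (g := (N ^ Kg)%N) :
  (c * (N * g.+1 + g.+1 + n.+1 * g.+1).+1 ^ k < N ^ (c + (Kg + 4) * k))%N.
Proof.
have N2 : (2 <= N)%N by rewrite /N; lia.
have g0 : (0 < g)%N by rewrite expn_gt0; lia.
have base : ((N * g.+1 + g.+1 + n.+1 * g.+1).+1 <= N ^ (Kg + 4))%N.
  rewrite expnD -/g; apply: (@leq_trans (g * (8 * N))%N); first by rewrite /N; nia.
  rewrite leq_mul2l !expnS expn0; apply/orP; right.
  have : (8 <= N * (N * N))%N by nia.
  nia.
rewrite expnD expnM; set b := ((_).+1 ^ k)%N.
have leb : (b <= (N ^ (Kg + 4)) ^ k)%N.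
  exact: leq_expl.
have b0 : (0 < b)%N by rewrite expn_gt0.
have ltc : (c < N ^ c)%N.
  apply: leq_trans (ltn_expl c (isT : (1 < 2)%N)) _.
  exact: leq_expl.
apply: (@leq_trans (N ^ c * b)%N); first by rewrite ltn_mul2r b0.
by rewrite leq_mul2l leb orbT.
Qed.

Lemma circ_weakly_learnable_of_e2e (L : nat) (p : {poly int}) :
  lin_e2e_learnable -> circ_weakly_learnable L p.
Proof.
case=> M [c] [k] [eps] [delta] [heps hdelta HM].
have [Kp HKp] := poly_le_power p.
(* [N ^ Kg] bounds the cube of the circuit size, as the Sidon times require, and [N ^ Kv] exceeds
   the running time of the e2e learner. *)
pose Kg := (Kp * 3)%N; pose Kv := (c + (Kg + 4) * k)%N.
pose K := (Kv + Kg + 2)%N; pose A := (prepare_cost Kv Kg + 12)%N.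
exists (learner M Kv Kg), (A * 2 ^ K)%N, K, eps, delta; split=> // n.
set t' := (_ * _ ^ _)%N.
pose N := (n + 2)%N; pose g := (N ^ Kg)%N.
pose t := (c * (N * g.+1 + g.+1 + n.+1 * g.+1).+1 ^ k)%N.
have ltV : (t < N ^ Kv)%N by exact: e2e_time_le.
have N0 : (0 < N)%N by rewrite /N addn2.
have W0 : (0 < N ^ K)%N by rewrite expn_gt0 N0.
have leVW : (N ^ Kv <= N ^ K)%N by rewrite leq_pexp2l // /K -addnA leq_addr.
(* The factor [2 ^ K] in the time bound comes from [n + 2 <= 2 * n.+1]. *)
have let' : (A * N ^ K <= t')%N.
  rewrite /t' -mulnA leq_mul2l -expnMn; apply/orP; right.
  by apply: leq_expl; rewrite /N; lia.
have fuel : (prepare_cost Kv Kg * N ^ K + t + 10 <= t')%N.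
  by apply: leq_trans let'; rewrite /A mulnDl; lia.
have leVt : (N ^ Kv <= t')%N by apply: leq_trans let'; rewrite /A; nia.
have le_tt : (t.+1 <= t'.+1)%N by lia.
have [HMrun HMlearn] := HM (N * g.+1)%N g.+1 (n.+1 * g.+1)%N.
rewrite -/t in HMrun HMlearn.
have sim x S r : size x = n -> size S = t'.+1 -> all (fun s => size s.1 == n) S ->
    size r = t'.+1 ->
    exists2 c', run t' (@init (learner M Kv Kg) (circ_input x) S r) = Some c' &
      out_bit (Some c') =
      out_bit (run t (@init M (e2e_input (N * g.+1) g.+1 (phi g x))
        (take t.+1 [seq (phi g s.1, s.2) | s <- S]) (take t.+1 r))).
  move=> sx sS okS sr.
  (* The e2e learner cannot run out of time here: the truncated spread examples and bits meet the
     hypotheses of its [runs_within]. *)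
  case E: (run t _) => [c'|]; last first.
    case: (HMrun _ _ _ _ _ _ _ E).
    - by rewrite size_phi sx.
    - by rewrite size_take_min size_map sS; apply/minn_idPl.
    - apply/allP => s /mem_take /mapP [s0 /(allP okS) /eqP s0n ->].
      by rewrite size_phi s0n.
    - by rewrite size_take_min sr; apply/minn_idPl.
  have ltr : (t < size r)%N by rewrite sr; lia.
  have leS : (N ^ Kv <= size S)%N by rewrite sS; lia.
  have [c'' runc out] := run_learner sx okS ltV leS ltr fuel E.
  by exists c''.
split=> [x S r sx sS okS sr|D C Ddist [[C0 _] cn_n _ Csize]].
  by have [c' ->] := sim x S r sx sS okS sr.
have gC : (cs C ^ 3 <= g)%N.
  by rewrite /g /Kg expnM; apply: leq_expl; apply: HKp.
have [w [b HC]] := circuit_as_generator C0 gC.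
rewrite cn_n in w HC.
have := HMlearn _ w b (is_distr_push g Ddist).
rewrite /learns -(@succ_prob_push M (learner M Kv Kg) t t' n g _ circ_input _ (circ_eval C)
  D eps le_tt) //; last first.
  by move=> x; apply: HC; rewrite size_tuple.
move=> s r x r' er; rewrite /hyp.
have [|||| c' -> ->] := sim x [seq ((s i : seq bool), circ_eval C (s i)) | i <- enum 'I_t'.+1] r.
- by rewrite size_tuple.
- by rewrite size_map size_enum_ord.
- by rewrite all_map; apply/allP => i _ /=; rewrite size_tuple.
- by rewrite size_tuple.
rewrite er -map_comp (take_ffun_samples le_tt); congr (out_bit (run _ (@init M _ _ _))).
apply: eq_map => i; rewrite /= ffunE /=; congr (_, _).
by rewrite HC // size_tuple.
Qed.

Theorem theorem4p4 :
  (exists (L : nat) (p : {poly int}), (0 < L)%N /\ ~ circ_weakly_learnable L p) ->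
  ~ lin_e2e_learnable.
Proof.
by move=> [L [p [_ hard]]] /(circ_weakly_learnable_of_e2e L p).
Qed.
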